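(* Let $p \in [1,\infty]$. The bifunctors of the normed vector spaces of equivalence classes of simple functions with values in normed vector spaces, under equality almost everywhere, have the following universal properties: (i) $(S^p,\sigma)$ is the initial object of the category $\mathbb{NV}_{\mathrm{emb}}^p$; that is, for every object $(F,c)$ of $\mathbb{NV}_{\mathrm{emb}}^p$ there exists exactly one morphism $(S^p,\sigma) \to (F,c)$ in $\mathbb{NV}_{\mathrm{emb}}^p$; (ii) $(S^p,\sigma)$ is the initial object of the category $\mathbb{NV}^p$; that is, for every object $(F,c)$ of $\mathbb{NV}^p$ there exists exactly one morphism $(S^p,\sigma) \to (F,c)$ in $\mathbb{NV}^p$.
   Context: Fix $\mathbb{K} = \mathbb{R}$ or $\mathbb{C}$. For a functor $F$, the action on a morphism $a$ is written $F_a$; for a category $\mathbf{A}$, $m^{\mathrm{op}}$ denotes the morphism of $\mathbf{A}^{\mathrm{op}}$ corresponding to the morphism $m$ of $\mathbf{A}$. A bifunctor is a functor on a product category. Measure spaces. An embedding of measure spaces $\iota \colon X \to Y$ is an injective map such that $A \subseteq X$ is measurable if and only if $\iota(A) \subseteq Y$ is measurable, and such that $\mu_X(A) = \mu_Y(\iota(A))$ for all measurable $A$. The category $\mathbf{Meas}_{\mathrm{emb}}$ has as objects the measure spaces with finite total measure and as morphisms the embeddings. Embeddings $Y \xrightarrow{\alpha} X \xleftarrow{\beta} Z$ are complementary if $\alpha(Y) \cap \beta(Z) = \emptyset$ and $\alpha(Y) \cup \beta(Z) = X$. A measure-preserving partial map $(D,q) \colon X \to Y$ is a measurable subset $D \subseteq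 X$ (with the unique measure space structure making $D \hookrightarrow X$ an embedding) together with a measure-preserving map $q \colon D \to Y$; the composite of $(D,q) \colon X \to Y$ and $(E,r) \colon Y \to Z$ is $(q^{-1}(E), r \circ q) \colon X \to Z$. The category $\mathbf{Meas}$ has as objects the measure spaces with finite total measure and as morphisms the measure-preserving partial maps. An embedding $\iota \colon X \to Y$ determines a morphism $(\iota(X),\iota^{-1}) \colon Y \to X$ in $\mathbf{Meas}$, and a measure-preserving map $m \colon Y \to X$ determines the morphism $(Y,m) \colon Y \to X$ in $\mathbf{Meas}$, also denoted $m$. Normed spaces. $\mathbf{NVect}_{\mathbb{K}}$ is the category of normed vector spaces over $\mathbb{K}$ and linear contractive maps (linear maps $T$ with $\lVert Tv\rVert \le \lVert v\rVert$). The category $\mathbb{NV}_{\mathrm{emb}}^p$. Objects are pairs $(F,c)$ where $F \colon \mathbf{Meas}_{\mathrm{emb}} \times \mathbf{NVect}_{\mathbb{K}} \to \mathbf{NVect}_{\mathbb{K}}$ is a bifunctor and $c$ assigns a bounded linear map $c_{(X,V)} \colon V \to F(X,V)$ to every object $(X,V)$, such that: (O) $F_{(\mathrm{id}_X,T)} \circ c_{(X,V)} = c_{(X,W)} \circ T$ for every object $X$ and every morphism $T \colon V \to W$ in $\mathbf{NVect}_{\mathbb{K}}$; (I) $F_{(\alpha,\mathrm{id}_V)} \circ c_{(Y,V)} + F_{(\beta,\mathrm{id}_V)} \circ c_{(Z,V)} = c_{(X,V)}$ for all $V$ and all complementary embeddings $Y \xrightarrow{\alpha} X \xleftarrow{\beta}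 Z$; (III) the operator norm satisfies $\lVert c_{(X,V)}\rVert \leq \mu_X(X)^{1/p}$ for all $(X,V)$, where for $p = \infty$ the expression $\mu_X(X)^{1/p}$ means $0$ if $\mu_X(X) = 0$ and $1$ otherwise; (IV) $\lVert F_{(\alpha,\mathrm{id}_V)}u + F_{(\beta,\mathrm{id}_V)}w\rVert_{F(X,V)} \leq (\lVert u\rVert_{F(Y,V)}^p + \lVert w\rVert_{F(Z,V)}^p)^{1/p}$ for all $V$, all complementary embeddings $Y \xrightarrow{\alpha} X \xleftarrow{\beta} Z$, all $u \in F(Y,V)$ and $w \in F(Z,V)$, where for $p = \infty$ the right-hand side means $\max\{\lVert u\rVert_{F(Y,V)},\lVert w\rVert_{F(Z,V)}\}$. A morphism $\psi \colon (F,c) \to (G,d)$ is a natural transformation $\psi \colon F \Rightarrow G$ with $\psi_{(X,V)} \circ c_{(X,V)} = d_{(X,V)}$ for all $(X,V)$. The category $\mathbb{NV}^p$. Objects are pairs $(F,c)$ where $F \colon \mathbf{Meas}^{\mathrm{op}} \times \mathbf{NVect}_{\mathbb{K}} \to \mathbf{NVect}_{\mathbb{K}}$ is a bifunctor and $c$ assigns a bounded linear map $c_{(X,V)} \colon V \to F(X,V)$ to every object $(X,V)$, satisfying (O), (III), and (I), (IV) with $F_{(\alpha,\mathrm{id}_V)}$, $F_{(\beta,\mathrm{id}_V)}$ replaced by $F_{((\alpha(Y),\alpha^{-1})^{\mathrm{op}},\mathrm{id}_V)}$, $F_{((\beta(Z),\beta^{-1})^{\mathrm{op}},\mathrm{id}_V)}$,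 and in addition (II) $F_{(m^{\mathrm{op}},\mathrm{id}_V)} \circ c_{(X,V)} = c_{(Y,V)}$ for every $V$ and every measure-preserving map $m \colon Y \to X$. Morphisms are defined as for $\mathbb{NV}_{\mathrm{emb}}^p$. The object $(S^p,\sigma)$. $S^p(X,V)$ is the space of equivalence classes, under equality almost everywhere, of simple functions $f \colon X \to V$ (finitely many values, measurable level sets), with norm $\lVert f\rVert = (\sum_{v \in V} \lVert v\rVert_V^p\, \mu_X(f^{-1}(v)))^{1/p}$ for $p < \infty$ and $\lVert f\rVert = \inf\{\epsilon \geq 0 : \lVert f(x)\rVert_V \leq \epsilon \text{ for a.e. } x \in X\}$ for $p = \infty$. On a morphism $(\iota,T) \colon (X,V) \to (Y,W)$ of $\mathbf{Meas}_{\mathrm{emb}} \times \mathbf{NVect}_{\mathbb{K}}$, $S^p_{(\iota,T)} f$ equals $T \circ f \circ \iota^{-1}$ on $\iota(X)$ and $0$ elsewhere. As a bifunctor on $\mathbf{Meas}^{\mathrm{op}} \times \mathbf{NVect}_{\mathbb{K}}$ (denoted by the same symbol), $S^p$ is the same on objects, is given by the same extension-by-zero formula on $((\iota(X),\iota^{-1})^{\mathrm{op}},T)$ for $\iota$ an embedding, and by $S^p_{(m^{\mathrm{op}},T)} f = T \circ f \circ m$ for $m \colon Y \to X$ measure-preserving; this determines it on all morphisms: for a measure-preserving partial map $(D,q)\colon Y \to X$, $S^p_{((D,q)^{\mathrm{op}},T)}f$ equals $T\circ f\circ q$ on $D$ and $0$ elsewhere. In both cases $\sigma_{(X,V)} \colon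 V \to S^p(X,V)$ sends $v$ to the class of the constant function on $X$ with value $v$. *)

(* Defs.v *)
From HB Require Import structures.
From mathcomp Require Import all_boot all_order all_algebra generic_quotient.
From mathcomp.real_closed Require Import complex.
From mathcomp Require Import all_classical all_reals all_analysis measurable_realfun.
Set Implicit Arguments.
Unset Strict Implicit.
Unset Printing Implicit Defensive.
Import Order.TTheory GRing.Theory Num.Theory.
Import numFieldNormedType.Exports.

Local Open Scope classical_set_scope.
Local Open Scope ring_scope.

Record category := Category {
  ob :> Type;
  hom : ob -> ob -> Type;
  idm : forall x, hom x x;
  compose : forall x y z, hom y z -> hom x y -> hom x z;
  comp_idl : forall x y (f : hom x y), compose (idm y) f = f;
  comp_idr : forall x y (f : hom x y), compose f (idm x) = f;
  comp_assoc : forall x y z t (h : hom z t) (g : hom y z) (f : hom x y),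
    compose h (compose g f) = compose (compose h g) f }.

Arguments hom {c} _ _.
Arguments idm {c} _.
Arguments compose {c x y z} _ _.

(* [m^op] is [m] itself, seen as a morphism of [op_cat C]. *)
Definition op_cat (C : category) : category :=
  @Category C (fun x y => @hom C y x) (fun x => idm x)
    (fun x y z g f => compose f g)
    (fun x y f => comp_idr f) (fun x y f => comp_idl f)
    (fun x y z t h g f => esym (comp_assoc f g h)).

Section product_category.
Variables C D : category.

Let phom (x y : C * D) : Type := (hom x.1 y.1 * hom x.2 y.2)%type.
Let pid (x : C * D) : phom x x := (idm x.1, idm x.2).
Let pcomp (x y z : C * D) (g : phom y z) (f : phom x y) : phom x z :=
  (compose g.1 f.1, compose g.2 f.2).

Let pidl x y (f : phom x y) : pcomp (pid y) f = f.
Proof. by case: f => f1 f2; rewrite /pcomp /= !comp_idl. Qed.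

Let pidr x y (f : phom x y) : pcomp f (pid x) = f.
Proof. by case: f => f1 f2; rewrite /pcomp /= !comp_idr. Qed.

Let passoc x y z t (h : phom z t) (g : phom y z) (f : phom x y) :
  pcomp h (pcomp g f) = pcomp (pcomp h g) f.
Proof. by rewrite /pcomp /= !comp_assoc. Qed.

Definition prod_cat : category :=
  @Category (C * D)%type phom pid pcomp pidl pidr passoc.

End product_category.

Record functor (C D : category) := Functor {
  fob :> C -> D;
  fhom : forall x y, hom x y -> hom (fob x) (fob y);
  fhom_id : forall x, fhom (idm x) = idm (fob x);
  fhom_comp : forall x y z (g : hom y z) (f : hom x y),
    fhom (compose g f) = compose (fhom g) (fhom f) }.

Record nattrans (C D : category) (F G : functor C D) := NatTrans {
  nat_at :> forall x, hom (F x) (G x);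
  nat_natural : forall x y (f : hom x y),
    compose (nat_at y) (fhom F f) = compose (fhom G f) (nat_at x) }.

Definition initial_object (C : category) (x : C) : Prop :=
  forall y : C, exists f : hom x y, forall g : hom x y, g = f.

Lemma nattrans_eq (C D : category) (F G : functor C D) (s t : nattrans F G) :
  (forall x, s x = t x) -> s = t.
Proof.
case: s t => [s sP] [t tP] /= st.
have {}st : s = t by exact: functional_extensionality_dep.
by case: t / st tP => tP; congr NatTrans; exact: Prop_irrelevance.
Qed.

Section nattrans_ops.
Variables C D : category.

Let idn_natural (F : functor C D) x y (f : hom x y) :
  compose (idm (F y)) (fhom F f) = compose (fhom F f) (idm (F x)).
Proof. by rewrite comp_idl comp_idr. Qed.

Definition nat_id (F : functor C D) : nattrans F F :=
  @NatTrans _ _ F F (fun x => idm (F x)) (@idn_natural F).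

Let compn_natural (F G H : functor C D) (t : nattrans G H) (s : nattrans F G)
  x y (f : hom x y) :
  compose (compose (t y) (s y)) (fhom F f) = compose (fhom H f) (compose (t x) (s x)).
Proof.
by rewrite -comp_assoc nat_natural comp_assoc nat_natural -comp_assoc.
Qed.

Definition nat_comp (F G H : functor C D) (t : nattrans G H)
    (s : nattrans F G) : nattrans F H :=
  @NatTrans _ _ F H (fun x => compose (t x) (s x)) (@compn_natural F G H t s).

End nattrans_ops.

Variant ground_field := Real_field | Complex_field.

Definition scalars (R : realType) (k : ground_field) : numFieldType :=
  match k with
  | Real_field => (R : numFieldType)
  | Complex_field => (R[i] : numFieldType)
  end.

Definition scalar_Re (R : realType) (k : ground_field) : scalars R k -> R :=
  match k with
  | Real_field => fun x : R => x
  | Complex_field => fun x : R[i] => complex.Re x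
  end.

Definition scalar_of (R : realType) (k : ground_field) : R -> scalars R k :=
  match k with
  | Real_field => fun x : R => x
  | Complex_field => fun x : R => (real_complex R x : R[i])
  end.

(* The library norm of a normed module over [scalars R k] takes its values in
   [scalars R k], more precisely in the nonnegative reals; [nrm] is this norm
   with values in [R]. *)
Definition nrm (R : realType) (k : ground_field)
  (V : normedModType (scalars R k)) (v : V) : R := scalar_Re `|v|.

Section scalar_theory.
Variables (R : realType) (k : ground_field).
Implicit Types x y : scalars R k.

Lemma scalar_ReD x y : scalar_Re (x + y) = scalar_Re x + scalar_Re y.
Proof. by case: k x y => // -[a b] [c d]. Qed.

Lemma scalar_Re_le x y : x <= y -> scalar_Re x <= scalar_Re y.
Proof. by case: k x y => //= x y; rewrite lecE => /andP[]. Qed.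

Lemma scalar_Re_ge0 x : 0 <= x -> 0 <= scalar_Re x.
Proof. by case: k x => //= x; rewrite lecE => /andP[]. Qed.

Lemma scalar_ReK x : 0 <= x -> scalar_of k (scalar_Re x) = x.
Proof. by case: k x => //= x x0; apply: RRe_real; exact: ger0_real. Qed.

Lemma scalar_ofK (r : R) : scalar_Re (scalar_of k r) = r.
Proof. by case: k. Qed.

Lemma scalar_ofD (r s : R) :
  scalar_of k (r + s) = scalar_of k r + scalar_of k s.
Proof. by case: k => //=; rewrite rmorphD. Qed.

Lemma scalar_ofM (r s : R) :
  scalar_of k (r * s) = scalar_of k r * scalar_of k s.
Proof. by case: k => //=; rewrite rmorphM. Qed.

Lemma scalar_of_le (r s : R) : (scalar_of k r <= scalar_of k s) = (r <= s).
Proof. by case: k => //=; rewrite lecR. Qed.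

Lemma scalar_of0 : scalar_of k 0 = 0 :> scalars R k.
Proof. by case: k. Qed.

Variable V : normedModType (scalars R k).
Implicit Types u v : V.

Lemma nrmE v : scalar_of k (nrm v) = `|v|.
Proof. by rewrite scalar_ReK. Qed.

Lemma nrm_ge0 v : 0 <= nrm v.
Proof. exact/scalar_Re_ge0. Qed.

Lemma nrmD u v : nrm (u + v) <= nrm u + nrm v.
Proof. by rewrite -scalar_ReD; apply/scalar_Re_le/ler_normD. Qed.

Lemma nrmZ (a : scalars R k) v : nrm (a *: v) = scalar_Re `|a| * nrm v.
Proof.
rewrite /nrm normrZ -{1}(@scalar_ReK `|a|)// -{1}(@scalar_ReK `|v|)//.
by rewrite -scalar_ofM scalar_ofK.
Qed.

Lemma nrm0 : nrm (0 : V) = 0.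
Proof. by rewrite /nrm normr0; case: k. Qed.

Lemma nrm0_eq0 v : nrm v = 0 -> v = 0.
Proof. by move=> v0; apply: normr0_eq0; rewrite -nrmE v0 scalar_of0. Qed.

End scalar_theory.

Section normed_spaces.
Variables (R : realType) (k : ground_field).
Notation K := (scalars R k).

Record contraction (V W : normedModType K) := Contraction {
  contr_lin :> {linear V -> W};
  contrP : forall v, `|contr_lin v| <= `|v| }.

Lemma linear_eq (V W : lmodType K) (f g : {linear V -> W}) :
  f =1 g -> f = g.
Proof.
case: f g => [f [[fD] [fZ]]] [g [[gD] [gZ]]] /= /funext fg.
rewrite -{g}fg in gD gZ *.
by rewrite (Prop_irrelevance fD gD) (Prop_irrelevance fZ gZ).
Qed.

Lemma contraction_eq (V W : normedModType K) (f g : contraction V W) :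
  f =1 g -> f = g.
Proof.
case: f g => [f fP] [g gP] /= /linear_eq fg.
by rewrite -{g}fg in gP *; congr Contraction; exact: Prop_irrelevance.
Qed.

Definition contr_id (V : normedModType K) : contraction V V :=
  @Contraction V V idfun (fun v => lexx `|v|).

Let contr_comp_subproof (U V W : normedModType K) (g : contraction V W)
  (f : contraction U V) u : `|(g \o f) u| <= `|u|.
Proof. exact: le_trans (contrP _ _) (contrP _ _). Qed.

Definition contr_comp (U V W : normedModType K) (g : contraction V W)
    (f : contraction U V) : contraction U W :=
  @Contraction U W (g \o f) (contr_comp_subproof g f).

Definition NVect : category.
Proof.
apply: (@Category (normedModType K) contraction contr_id contr_comp).
- by move=> V W f; exact: contraction_eq.
- by move=> V W f; exact: contraction_eq.
- by move=> U V W Z h g f; exact: contraction_eq.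
Defined.

Record bounded_linear (V W : normedModType K) := BoundedLinear {
  bdd_lin :> {linear V -> W};
  bddP : exists C : R, forall v, nrm (bdd_lin v) <= C * nrm v }.

Definition opnorm (V W : normedModType K) (f : V -> W) : R :=
  inf [set C : R | 0 <= C /\ forall v, nrm (f v) <= C * nrm v].

End normed_spaces.

(* The library's [measurableType] is always pointed, which would exclude the
   empty measure space; hence this structure on an arbitrary type. As for the
   library measures, the values of the measure on nonmeasurable sets are
   irrelevant. *)
Record measSpace (R : realType) := MeasSpace {
  carrier :> Type;
  mset : set (set carrier);
  mu : set carrier -> \bar R;
  mset_sigma_algebra : sigma_algebra [set: carrier] mset;
  mu_set0 : mu set0 = 0%E;
  mu_ge0 : forall A, (0 <= mu A)%E;
  mu_sigma_additive : forall F : (set carrier)^nat, (forall n, mset (F n)) ->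
    trivIset setT F ->
    (fun n => \sum_(0 <= i < n) mu (F i))%E @ \oo --> mu (\bigcup_n F n);
  mu_finite : (mu [set: carrier] < +oo)%E }.

Arguments mset {R m} _.
Arguments mu {R} m _.

Section measure_spaces.
Variable R : realType.
Implicit Types X Y Z : measSpace R.

Record embedding Y X := Embedding {
  emb_fun :> Y -> X;
  emb_inj : injective emb_fun;
  emb_mset : forall A : set Y, mset A <-> mset (emb_fun @` A);
  emb_mu : forall A : set Y, mset A -> mu Y A = mu X (emb_fun @` A) }.

Lemma embedding_eq Y X (f g : embedding Y X) : f =1 g -> f = g.
Proof.
case: f g => [f f1 f2 f3] [g g1 g2 g3] /= /funext fg.
case: g / fg g1 g2 g3 => g1 g2 g3.
by congr Embedding; exact: Prop_irrelevance.
Qed.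

Let emb_id_mset X (A : set X) : mset A <-> mset (id @` A).
Proof. by rewrite image_id. Qed.

Let emb_id_mu X (A : set X) : mset A -> mu X A = mu X (id @` A).
Proof. by rewrite image_id. Qed.

Definition emb_id X : embedding X X :=
  @Embedding X X id (fun _ _ => id) (@emb_id_mset X) (@emb_id_mu X).

Section emb_comp.
Variables (X Y Z : measSpace R) (g : embedding Y Z) (f : embedding X Y).

Let emb_comp_mset (A : set X) : mset A <-> mset ((g \o f) @` A).
Proof. by rewrite -image_comp -emb_mset -emb_mset. Qed.

Let emb_comp_mu (A : set X) : mset A -> mu X A = mu Z ((g \o f) @` A).
Proof.
by move=> mA; rewrite -image_comp -emb_mu -?emb_mset// -emb_mu.
Qed.

Definition emb_comp : embedding X Z :=
  @Embedding X Z (g \o f) (inj_comp (@emb_inj _ _ g) (@emb_inj _ _ f))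
    emb_comp_mset emb_comp_mu.

End emb_comp.

Definition Meas_emb : category.
Proof.
apply: (@Category (measSpace R) embedding emb_id emb_comp).
- by move=> X Y f; exact: embedding_eq.
- by move=> X Y f; exact: embedding_eq.
- by move=> X Y Z T h g f; exact: embedding_eq.
Defined.

Definition complementary Y X Z (a : embedding Y X) (b : embedding Z X) :=
  range a `&` range b = set0 /\ range a `|` range b = [set: X].

(* A partial map (D, q) is encoded as a function [f] to [option Y]: [D] is the
   set of the [x] such that [f x] is not [None], and [f x = Some (q x)] for
   [x] in [D]. Hence [f @^-1` (Some @` B)] is the set q^-1(B); the measurability
   of [D] is the case [B = setT]. *)
Record pmap X Y := PMap {
  pmap_fun :> X -> option Y;
  pmap_mset : forall B : set Y, mset B -> mset (pmap_fun @^-1` (Some @` B));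
  pmap_mu : forall B : set Y, mset B ->
    mu X (pmap_fun @^-1` (Some @` B)) = mu Y B }.

Lemma pmap_eq X Y (f g : pmap X Y) : f =1 g -> f = g.
Proof.
case: f g => [f f1 f2] [g g1 g2] /= /funext fg.
case: g / fg g1 g2 => g1 g2.
by congr PMap; exact: Prop_irrelevance.
Qed.

Lemma preimage_SomeK X (A : set X) : Some @^-1` (Some @` A) = A.
Proof.
by apply/seteqP; split=> [x [y Ay [<-]]//|x Ax]; exists x.
Qed.

Record mpmap X Y := MPMap {
  mp_fun :> X -> Y;
  mp_mset : forall B : set Y, mset B -> mset (mp_fun @^-1` B);
  mp_mu : forall B : set Y, mset B -> mu X (mp_fun @^-1` B) = mu Y B }.

Let total_mset X Y (m : mpmap X Y) (B : set Y) :
  mset B -> mset ((Some \o m) @^-1` (Some @` B)).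
Proof. by rewrite comp_preimage preimage_SomeK; exact: mp_mset. Qed.

Let total_mu X Y (m : mpmap X Y) (B : set Y) :
  mset B -> mu X ((Some \o m) @^-1` (Some @` B)) = mu Y B.
Proof. by rewrite comp_preimage preimage_SomeK; exact: mp_mu. Qed.

Definition total_pmap X Y (m : mpmap X Y) : pmap X Y :=
  @PMap X Y (Some \o m) (total_mset m) (total_mu m).

Definition mp_id X : mpmap X X :=
  @MPMap X X id (fun _ => id) (fun _ _ => erefl).

Section pmap_comp.
Variables (X Y Z : measSpace R) (g : pmap Y Z) (f : pmap X Y).

(* [obind g (f x)] is defined if and only if x lies in f^-1 (dom g). *)
Definition pmap_comp_fun (x : X) : option Z := obind g (f x).

Lemma pmap_comp_preimage (C : set Z) :
  pmap_comp_fun @^-1` (Some @` C) =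
  f @^-1` (Some @` (g @^-1` (Some @` C))).
Proof.
apply/seteqP; split=> x /=; rewrite /pmap_comp_fun.
- by case=> c Cc; case: (f x) => [y|]//= gyc; exists y => //; exists c.
- by move=> [y [c Cc gyc] <-] /=; exists c.
Qed.

Let pmap_comp_mset (C : set Z) :
  mset C -> mset (pmap_comp_fun @^-1` (Some @` C)).
Proof. by move=> mC; rewrite pmap_comp_preimage; do 2 apply: pmap_mset. Qed.

Let pmap_comp_mu (C : set Z) :
  mset C -> mu X (pmap_comp_fun @^-1` (Some @` C)) = mu Z C.
Proof.
move=> mC; rewrite pmap_comp_preimage !pmap_mu//.
exact: pmap_mset.
Qed.

Definition pmap_comp : pmap X Z := PMap pmap_comp_mset pmap_comp_mu.

End pmap_comp.

Definition Meas : category.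
Proof.
apply: (@Category (measSpace R) pmap (fun X => total_pmap (mp_id X)) pmap_comp).
- by move=> X Y f; apply: pmap_eq => x /=; rewrite /pmap_comp_fun; case: (f x).
- by move=> X Y f; exact: pmap_eq.
- move=> X Y Z T h g f; apply: pmap_eq => x /=.
  by rewrite /pmap_comp_fun/= /pmap_comp_fun; case: (f x).
Defined.

Section emb_inv.
Variables (X Y : measSpace R) (i : embedding X Y).

Definition emb_inv_fun (y : Y) : option X :=
  if pselect (exists x, i x = y) is left e then Some (projT1 (cid e)) else None.

Lemma emb_inv_funE x : emb_inv_fun (i x) = Some x.
Proof.
rewrite /emb_inv_fun; case: pselect => [e|[]]; last by exists x.
by congr Some; apply: (@emb_inj _ _ i); case: cid.
Qed.

Lemma emb_inv_funN y : ~ range i y -> emb_inv_fun y = None.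
Proof.
move=> yi; rewrite /emb_inv_fun; case: pselect => // -[x ixy].
by case: yi; exists x.
Qed.

Lemma emb_inv_preimage (B : set X) : emb_inv_fun @^-1` (Some @` B) = i @` B.
Proof.
apply/seteqP; split=> [y /=|_ [x Bx <-] /=]; last first.
  by rewrite emb_inv_funE; exists x.
have [[x _ <-]|yi] := pselect (range i y); last first.
  by rewrite emb_inv_funN// => -[].
by rewrite emb_inv_funE => -[x' Bx' [<-]]; exists x'.
Qed.

Let emb_inv_mset (B : set X) : mset B -> mset (emb_inv_fun @^-1` (Some @` B)).
Proof. by rewrite emb_inv_preimage -emb_mset. Qed.

Let emb_inv_mu (B : set X) :
  mset B -> mu Y (emb_inv_fun @^-1` (Some @` B)) = mu X B.
Proof. by move=> mB; rewrite emb_inv_preimage -emb_mu. Qed.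

(* The morphism (i(X), i^-1) from Y to X. *)
Definition emb_inv : pmap Y X := PMap emb_inv_mset emb_inv_mu.

End emb_inv.

Lemma emb_inv_id X : emb_inv (emb_id X) = total_pmap (mp_id X).
Proof.
by apply: pmap_eq => x /=; rewrite -[x in LHS]/(emb_id X x) emb_inv_funE.
Qed.

Lemma emb_inv_comp X Y Z (g : embedding Y Z) (f : embedding X Y) :
  emb_inv (emb_comp g f) = pmap_comp (emb_inv f) (emb_inv g).
Proof.
apply: pmap_eq => z /=; rewrite /pmap_comp_fun.
have [[y _ <-]|zg] := pselect (range g z); last first.
  rewrite [emb_inv g z]emb_inv_funN//= emb_inv_funN// => -[x _ /= gfx].
  by apply: zg; exists (f x).
rewrite [emb_inv g _]emb_inv_funE/=.
have [[x _ <-]|yf] := pselect (range f y); last first.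
  rewrite !emb_inv_funN// => -[x _ /= gfx].
  by apply: yf; exists x => //; exact: (@emb_inj _ _ g).
by rewrite emb_inv_funE -[g (f x)]/(emb_comp g f x) emb_inv_funE.
Qed.

Definition negligible_set X (A : set X) :=
  exists N : set X, [/\ mset N, mu X N = 0%E & A `<=` N].

Definition almost_every X (P : X -> Prop) := negligible_set (~` [set x | P x]).

End measure_spaces.

(* [option X] with [None] as an additional null point is a library
   [measurableType], which gives access to the library's integral in the proofs
   that S^p(X, V) is a normed space. *)
Section pointed_space.
Variables (R : realType) (X : measSpace R).

Definition opt_space : Type := option X.
HB.instance Definition _ := gen_eqMixin opt_space.
HB.instance Definition _ := gen_choiceMixin opt_space.
HB.instance Definition _ := isPointed.Build opt_space None.

Definition opt_mset (A : set opt_space) := mset (Some @^-1` A : set X).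

Let opt_mset0 : opt_mset set0.
Proof. by rewrite /opt_mset preimage_set0; have [] := mset_sigma_algebra X. Qed.

Let opt_msetC A : opt_mset A -> opt_mset (~` A).
Proof.
rewrite /opt_mset preimage_setC => mA.
by rewrite -setTD; have [_ + _] := mset_sigma_algebra X; exact.
Qed.

Let opt_mset_bigcup (F : (set opt_space)^nat) :
  (forall n, opt_mset (F n)) -> opt_mset (\bigcup_n F n).
Proof.
move=> mF; rewrite /opt_mset preimage_bigcup.
by have [_ _] := mset_sigma_algebra X; apply.
Qed.

HB.instance Definition _ := @isMeasurable.Build default_measure_display
  opt_space opt_mset opt_mset0 opt_msetC opt_mset_bigcup.

Definition opt_mu (A : set opt_space) : \bar R := mu X (Some @^-1` A).

Let opt_mu0 : opt_mu set0 = 0%E.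
Proof. by rewrite /opt_mu preimage_set0 mu_set0. Qed.

Let opt_mu_ge0 A : (0 <= opt_mu A)%E.
Proof. exact: mu_ge0. Qed.

Let opt_mu_sigma_additive : semi_sigma_additive opt_mu.
Proof.
move=> F mF tF _; rewrite /opt_mu preimage_bigcup.
apply: mu_sigma_additive => //.
move=> i j _ _ [x [/= Fi Fj]]; apply: (tF i j) => //.
by exists (Some x).
Qed.

HB.instance Definition _ :=
  isMeasure.Build _ _ _ opt_mu opt_mu0 opt_mu_ge0 opt_mu_sigma_additive.

End pointed_space.

Section measure_space_theory.
Variables (R : realType) (X : measSpace R).
Implicit Types A B : set X.
Let opt := (opt_space X).
Let Some' : X -> opt := Some.

Lemma opt_measurable A : measurable (Some' @` A) = mset A.
Proof. by rewrite [LHS]/(opt_mset _)/opt_mset preimage_SomeK. Qed.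

Lemma opt_muE A : opt_mu (Some' @` A) = mu X A.
Proof. by rewrite /opt_mu preimage_SomeK. Qed.

Lemma mset0 : mset (set0 : set X).
Proof. by have [] := mset_sigma_algebra X. Qed.

Lemma msetC A : mset A -> mset (~` A).
Proof.
by rewrite -setTD => mA; have [_ + _] := mset_sigma_algebra X; exact.
Qed.

Lemma msetT : mset [set: X].
Proof. by rewrite -setC0; exact/msetC/mset0. Qed.

Lemma mset_fin_bigcup (I : choiceType) (D : set I) (F : I -> set X) :
  finite_set D -> (forall i, D i -> mset (F i)) -> mset (\bigcup_(i in D) F i).
Proof.
move=> fD mF; rewrite -opt_measurable image_bigcup.
by apply: fin_bigcup_measurable => // i Di; rewrite opt_measurable; exact: mF.
Qed.

Lemma msetU A B : mset A -> mset B -> mset (A `|` B).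
Proof.
by rewrite -3!opt_measurable image_setU; exact: measurableU.
Qed.

Lemma msetI A B : mset A -> mset B -> mset (A `&` B).
Proof.
move=> mA mB; rewrite -[_ `&` _]setCK setCI; apply: msetC.
by apply: msetU; exact: msetC.
Qed.

Lemma mu_le A B : mset A -> mset B -> A `<=` B -> (mu X A <= mu X B)%E.
Proof.
move=> mA mB AB; rewrite -2!opt_muE; apply: le_measure.
- by rewrite inE opt_measurable.
- by rewrite inE opt_measurable.
- exact: image_subset.
Qed.

Lemma mu_fin_num A : mset A -> mu X A \is a fin_num.
Proof.
move=> mA; rewrite ge0_fin_numE ?mu_ge0//.
by apply: le_lt_trans (mu_finite X); apply: mu_le => //; exact: msetT.
Qed.

Lemma mu_fineK A : mset A -> (fine (mu X A))%:E = mu X A.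
Proof. by move=> mA; rewrite fineK// mu_fin_num. Qed.

Lemma fine_mu_ge0 A : 0 <= fine (mu X A).
Proof. exact/fine_ge0/mu_ge0. Qed.

Lemma negligible_setE A :
  negligible_set A <-> (@opt_mu R X).-negligible (Some' @` A).
Proof.
split=> [[N [mN N0 AN]]|[N [mN N0 AN]]].
- exists (Some' @` N); split; first by rewrite opt_measurable.
    by rewrite opt_muE.
  exact: image_subset.
- exists (Some' @^-1` N); split=> // x Ax; apply: AN.
  by exists x.
Qed.

Lemma negligible_setS A B :
  A `<=` B -> negligible_set B -> negligible_set A.
Proof. by move=> AB [N [mN N0 BN]]; exists N; split=> //; apply: subset_trans BN. Qed.

Lemma negligible_setU A B :
  negligible_set A -> negligible_set B -> negligible_set (A `|` B).
Proof. by rewrite !negligible_setE image_setU; exact: negligibleU. Qed.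

Lemma negligible_set0 : negligible_set (set0 : set X).
Proof. by exists set0; split=> //; [exact: mset0|exact: mu_set0]. Qed.

Lemma negligible_fin_bigcup (I : choiceType) (D : set I) (F : I -> set X) :
  finite_set D -> (forall i, D i -> negligible_set (F i)) ->
  negligible_set (\bigcup_(i in D) F i).
Proof.
move=> fD nF; rewrite -fsbig_setU// fsbig_finite//.
rewrite big_seq; elim/big_ind: _ => [|A B|i].
- exact: negligible_set0.
- exact: negligible_setU.
- by rewrite in_fset_set// inE => /nF.
Qed.

Lemma negligible_mset A : mset A -> negligible_set A -> mu X A = 0%E.
Proof.
move=> mA [N [mN N0 AN]]; apply/eqP; rewrite eq_le mu_ge0 andbT -N0.
exact: mu_le.
Qed.

Lemma almost_everyW (P : X -> Prop) : (forall x, P x) -> almost_every P.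
Proof.
move=> PT; apply: negligible_setS negligible_set0 => x /=; apply.
exact: PT.
Qed.

Lemma almost_everyS (P Q : X -> Prop) :
  (forall x, P x -> Q x) -> almost_every P -> almost_every Q.
Proof. by move=> PQ; apply: negligible_setS => x /= nQ /PQ. Qed.

Lemma almost_everyI (P Q S : X -> Prop) :
  (forall x, P x -> Q x -> S x) ->
  almost_every P -> almost_every Q -> almost_every S.
Proof.
move=> PQS aP aQ; apply: negligible_setS (negligible_setU aP aQ) => x /= nS.
by apply/not_andP => -[Px Qx]; apply: nS; exact: PQS.
Qed.

Lemma almost_every_pmap (Y : measSpace R) (q : pmap Y X) (P : X -> Prop) :
  almost_every P -> almost_every (fun y => if q y is Some x then P x else True).
Proof.
move=> [N [mN N0 PN]]; exists (q @^-1` (Some @` N)); split.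
- exact: pmap_mset.
- by rewrite pmap_mu.
- by move=> y /=; case: (q y) => [x nPx|//]; exists x => //; exact: PN.
Qed.

End measure_space_theory.

Definition simple_function (R : realType) (X : measSpace R) (V : Type)
    (f : X -> V) : Prop :=
  finite_set (range f) /\ forall v, mset (f @^-1` [set v]).

Section simple_function_theory.
Variables (R : realType) (X : measSpace R).

Lemma simple_preimage (V : choiceType) (f : X -> V) (A : set V) :
  simple_function f -> mset (f @^-1` A).
Proof.
move=> [ff mf].
have -> : f @^-1` A = \bigcup_(v in range f `&` A) f @^-1` [set v].
  apply/seteqP; split=> [x Afx|x [v [_ Av] /= ->//]].
  by exists (f x) => //; split=> //; exists x.
by apply: mset_fin_bigcup => //; exact: finite_setIl.
Qed.

Lemma simple_cst (V : Type) (v : V) : simple_function (fun _ : X => v).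
Proof.
split; first by apply: sub_finite_set (finite_set1 v) => _ [x _ <-].
move=> w; have [->|vw] := pselect (v = w).
  by rewrite (_ : _ @^-1` _ = setT); [exact: msetT|apply/seteqP].
rewrite (_ : _ @^-1` _ = set0); first exact: mset0.
by apply/seteqP; split=> // x /vw.
Qed.

Lemma simple_comp (V : choiceType) (W : Type) (phi : V -> W) (f : X -> V) :
  simple_function f -> simple_function (phi \o f).
Proof.
move=> sf; split; last by move=> w; rewrite comp_preimage; exact: simple_preimage.
by rewrite -(image_comp f phi); apply: finite_image; have [] := sf.
Qed.

Lemma simple_comp2 (V W : choiceType) (Z : Type) (op : V -> W -> Z)
    (f : X -> V) (g : X -> W) : simple_function f -> simple_function g ->
  simple_function (fun x => op (f x) (g x)).
Proof.
move=> sf sg; split.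
  apply: (@sub_finite_set _ _ [set op v w | v in range f & w in range g]).
    by move=> _ [x _ <-]; exists (f x); [exists x|exists (g x) => //; exists x].
  by apply: finite_image2; [have [] := sf|have [] := sg].
move=> z.
have -> : (fun x => op (f x) (g x)) @^-1` [set z] =
    \bigcup_(v in range f) (f @^-1` [set v] `&` g @^-1` (op v @^-1` [set z])).
  apply/seteqP; split=> [x /= opz|x [v _ [/= <-//]]].
  by exists (f x) => //; exists x.
apply: mset_fin_bigcup; first by have [] := sf.
by move=> v _; apply: msetI; exact: simple_preimage.
Qed.

Lemma almost_every_mset (A B : set X) : mset A -> mset B ->
  almost_every (fun x => A x -> B x) -> (mu X A <= mu X B)%E.
Proof.
move=> mA mB /negligible_setE [N [mN N0 AN]].
rewrite -2!opt_muE; apply: (@le_trans _ _ (opt_mu (Some @` B `|` N))).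
  apply: le_measure; rewrite ?inE ?opt_measurable//.
    by apply: measurableU => //; rewrite opt_measurable.
  move=> _ [x Ax <-]; have [Bx|nBx] := pselect (B x).
    by left; exists x.
  by right; apply: AN; exists x => // /(_ Ax).
have mB' : measurable ((Some : X -> opt_space X) @` B).
  by rewrite opt_measurable.
apply: le_trans (measureU2 (@opt_mu R X) mB' mN) _.
by rewrite [X in (_ + X)%E]N0 adde0.
Qed.

Lemma almost_every_eq_mu (A B : set X) : mset A -> mset B ->
  almost_every (fun x => A x <-> B x) -> mu X A = mu X B.
Proof.
move=> mA mB AB; apply/eqP; rewrite eq_le; apply/andP; split.
  by apply: almost_every_mset => //; apply: almost_everyS AB => x [].
by apply: almost_every_mset => //; apply: almost_everyS AB => x [].
Qed.

Definition opt_ext (h : X -> R) (o : opt_space X) : R :=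
  if o is Some x then h x else 0.

Lemma measurable_opt_ext (h : X -> R) :
  simple_function h -> measurable_fun [set: opt_space X] (opt_ext h).
Proof.
move=> sh _ A _; rewrite setTI.
rewrite [measurable _]/(opt_mset _) /opt_mset -comp_preimage.
exact: simple_preimage.
Qed.

Section simple_integral.
Variable V : choiceType.
Implicit Types (f g : X -> V) (phi : V -> R).

Definition simple_integral phi f : R :=
  \sum_(v \in [set: V]) phi v * fine (mu X (f @^-1` [set v])).

Let preimage0 f v : ~ range f v -> f @^-1` [set v] = set0.
Proof. by move=> fv; apply/seteqP; split=> // x /= fx; apply: fv; exists x. Qed.

Lemma simple_integral_range phi f : simple_integral phi f =
  \sum_(v \in range f) phi v * fine (mu X (f @^-1` [set v])).
Proof.
apply: esym; apply: fsbig_widen => // v [_ /= /preimage0 ->].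
by rewrite mu_set0 mulr0.
Qed.

Lemma simple_integralE phi f : simple_function f -> (forall v, 0 <= phi v) ->
  (\int[@opt_mu R X]_o (opt_ext (phi \o f) o)%:E)%E =
  (simple_integral phi f)%:E.
Proof.
move=> sf phi0; have fr : finite_set (range f) by have [] := sf.
pose F v o := ((phi v)%:E *
  (\1_((Some : X -> opt_space X) @` (f @^-1` [set v])) o)%:E)%E.
have mf v : measurable ((Some : X -> opt_space X) @` (f @^-1` [set v])).
  by rewrite opt_measurable; have [] := sf.
transitivity (\int[@opt_mu R X]_o (\sum_(v \in range f) F v o))%E.
  apply: eq_integral => -[x|] _ /=; last first.
    rewrite fsbig1// => v _; rewrite /F indicE memNset ?mule0//.
    by case.
  rewrite (fsbigD1 (f x))//=; last by exists x.
  rewrite {1}/F indicE mem_set ?mule1; last by exists x.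
  rewrite fsbig1 ?adde0// => v [_ /= /eqP vfx].
  rewrite /F indicE memNset ?mule0// => -[y /= fy [yx]].
  by move: vfx; rewrite -fy yx eqxx.
rewrite ge0_integral_fsum//; last 2 first.
- move=> v; apply: measurable_funeM; apply/measurable_EFinP.
  exact: measurable_indic.
- by move=> v o _; rewrite /F -EFinM lee_fin mulr_ge0.
rewrite simple_integral_range -fsumEFin//; apply: eq_fsbigr => v _.
rewrite /F ge0_integralZl_EFin//; last first.
  by apply/measurable_EFinP; exact: measurable_indic.
rewrite integral_indic// setIT EFinM mu_fineK; last by have [] := sf.
by congr (_ * _)%E; exact: opt_muE.
Qed.

Lemma simple_integral_ae phi f g : simple_function f -> simple_function g ->
  almost_every (fun x => f x = g x) ->
  simple_integral phi f = simple_integral phi g.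
Proof.
move=> [_ mf] [_ mg] fg; apply: eq_fsbigr => v _; congr (_ * fine _).
by apply: almost_every_eq_mu => //; apply: almost_everyS fg => x /= ->.
Qed.

Lemma simple_integral_ge0 phi f : (forall v, 0 <= phi v) ->
  0 <= simple_integral phi f.
Proof.
by move=> phi0; apply: fsumr_ge0 => v _; rewrite mulr_ge0// fine_mu_ge0.
Qed.

Lemma simple_integral_eq0 phi f : simple_function f ->
  (forall v, 0 <= phi v) -> simple_integral phi f = 0 ->
  almost_every (fun x => phi (f x) = 0).
Proof.
move=> sf phi0; rewrite simple_integral_range => I0.
have [fr mf] := sf.
have {}I0 v : range f v -> phi v != 0 -> mu X (f @^-1` [set v]) = 0%E.
  move=> fv phiv.
  have : phi v * fine (mu X (f @^-1` [set v])) = 0.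
    have := @pfsumr_eq0 _ _ (range f)
      (fun v => phi v * fine (mu X (f @^-1` [set v]))) fr; apply => //.
    by move=> w _; rewrite mulr_ge0// fine_mu_ge0.
  move/eqP; rewrite mulf_eq0 (negbTE phiv)/= => /eqP muv.
  by rewrite -mu_fineK// muv.
apply: (@negligible_setS _ _ _
  (\bigcup_(v in range f `&` [set v | phi v != 0]) (f @^-1` [set v]))).
  by move=> x /= /eqP phix; exists (f x) => //; split=> //; exists x.
apply: negligible_fin_bigcup; first exact: finite_setIl.
by move=> v [fv phiv]; exists (f @^-1` [set v]); split=> //; exact: I0.
Qed.

End simple_integral.

Lemma simple_integral_le (V W : choiceType) (phi : V -> R) (psi : W -> R)
    (f : X -> V) (g : X -> W) : simple_function f -> simple_function g ->
  (forall v, 0 <= phi v) -> (forall w, 0 <= psi w) ->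
  (forall x, phi (f x) <= psi (g x)) ->
  simple_integral phi f <= simple_integral psi g.
Proof.
move=> sf sg phi0 psi0 le_fg; rewrite -lee_fin -!simple_integralE//.
apply: ge0_le_integral => //.
- by move=> -[x|] _ //=; rewrite lee_fin.
- by apply/measurable_EFinP/measurable_opt_ext; exact: simple_comp.
- by apply/measurable_EFinP/measurable_opt_ext; exact: simple_comp.
- by move=> -[x|] _ //=; rewrite lee_fin.
Qed.

Lemma simple_integralD (V V' W : choiceType) (phi : V -> R) (phi' : V' -> R)
    (psi : W -> R) (f : X -> V) (f' : X -> V') (g : X -> W) :
  simple_function f -> simple_function f' -> simple_function g ->
  (forall v, 0 <= phi v) -> (forall v, 0 <= phi' v) -> (forall w, 0 <= psi w) ->
  (forall x, psi (g x) = phi (f x) + phi' (f' x)) ->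
  simple_integral psi g = simple_integral phi f + simple_integral phi' f'.
Proof.
move=> sf sf' sg phi0 phi'0 psi0 gE; apply: EFin_inj.
rewrite EFinD -!simple_integralE// -ge0_integralD//.
- by apply: eq_integral => -[x|] _ /=; rewrite -EFinD ?gE ?addr0.
- by move=> -[x|] _ //=; rewrite lee_fin.
- by apply/measurable_EFinP/measurable_opt_ext; exact: simple_comp.
- by move=> -[x|] _ //=; rewrite lee_fin.
- by apply/measurable_EFinP/measurable_opt_ext; exact: simple_comp.
Qed.

End simple_function_theory.

Section Sp_norm_definition.
Variables (R : realType) (k : ground_field) (p : \bar R).
Variables (X : measSpace R) (V : normedModType (scalars R k)).

Definition Sp_norm (f : X -> V) : R :=
  match p with
  | r%:E =>
    (\sum_(v \in [set: V]) nrm v `^ r * fine (mu X (f @^-1` [set v]))) `^ r^-1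
  | +oo%E => inf [set e : R | 0 <= e /\ almost_every (fun x => nrm (f x) <= e)]
  | -oo%E => 0
  end.

End Sp_norm_definition.

(* mu_X(X)^(1/p); here and below the value for p = -oo is irrelevant, since p is
   at least 1. *)
Definition mass_root (R : realType) (p : \bar R) (X : measSpace R) : R :=
  match p with
  | r%:E => fine (mu X [set: X]) `^ r^-1
  | +oo%E => if mu X [set: X] == 0%E then 0 else 1
  | -oo%E => 0
  end.

(* (a^p + b^p)^(1/p) *)
Definition lp_pair (R : realType) (p : \bar R) (a b : R) : R :=
  match p with
  | r%:E => (a `^ r + b `^ r) `^ r^-1
  | +oo%E => Num.max a b
  | -oo%E => 0
  end.

Lemma lp_pair_le (R : realType) (p : \bar R) (a b a' b' : R) : (1 <= p)%E ->
  0 <= a -> 0 <= b -> a <= a' -> b <= b' -> lp_pair p a b <= lp_pair p a' b'.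
Proof.
case: p => [r| |] // r1 a0 b0 aa' bb'; last first.
  by rewrite /lp_pair ge_max !le_max aa' bb' orbT.
have r0 : 0 <= r by rewrite (le_trans ler01).
have a'0 := le_trans a0 aa'; have b'0 := le_trans b0 bb'.
apply: ge0_ler_powR; rewrite ?nnegrE ?invr_ge0 ?addr_ge0 ?powR_ge0//.
by apply: lerD; apply: ge0_ler_powR; rewrite // nnegrE.
Qed.

Section Sp_norm_theory.
Variables (R : realType) (k : ground_field).
Notation K := (scalars R k).

Section fixed_space.
Variables (X : measSpace R) (V : normedModType K).
Implicit Types f g : X -> V.

Let powr (r : R) (v : V) : R := nrm v `^ r.

Let powr_ge0 r v : 0 <= powr r v. Proof. exact: powR_ge0. Qed.

Lemma Sp_normE r f : Sp_norm r%:E f = simple_integral (powr r) f `^ r^-1.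
Proof. by []. Qed.

Lemma Sp_normX r f : 1 <= r -> Sp_norm r%:E f `^ r = simple_integral (powr r) f.
Proof.
move=> r1; rewrite Sp_normE -powRrM mulVf ?gt_eqF ?(lt_le_trans ltr01)//.
by rewrite powRr1// simple_integral_ge0.
Qed.

Lemma simple_bounded f : simple_function f ->
  exists2 M : R, 0 <= M & forall x, nrm (f x) <= M.
Proof.
move=> [/finite_seqP[s fs] _]; exists (\sum_(v <- undup s) nrm v).
  by apply: sumr_ge0 => v _; exact: nrm_ge0.
move=> x; rewrite (bigD1_seq (f x)) ?undup_uniq//=.
  by rewrite lerDl; apply: sumr_ge0 => v _; exact: nrm_ge0.
have : range f (f x) by exists x.
by rewrite fs /= mem_undup.
Qed.

Lemma Sp_normy_le f e : 0 <= e -> almost_every (fun x => nrm (f x) <= e) ->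
  Sp_norm +oo%E f <= e.
Proof. by move=> e0 fe; apply: ge_inf => //; exists 0 => y []. Qed.

Lemma Sp_normy_ae f : simple_function f ->
  almost_every (fun x => nrm (f x) <= Sp_norm +oo%E f).
Proof.
move=> sf; apply: (@negligible_setS _ _ _
  (\bigcup_(v in range f `&` [set v | Sp_norm +oo%E f < nrm v])
     (f @^-1` [set v]))).
  move=> x /= /negP; rewrite -ltNge => fx.
  by exists (f x) => //; split=> //; exists x.
apply: negligible_fin_bigcup; first by apply: finite_setIl; have [] := sf.
move=> v [_ /= /inf_lt].
have [M M0 fM] := simple_bounded sf.
case; first by exists M; split=> //; exact: almost_everyW.
move=> e [e0 ae_e] ev; apply: negligible_setS ae_e => x /= ->.
by apply/negP; rewrite -ltNge.
Qed.

Lemma Sp_norm_ge0 p f : 0 <= Sp_norm p f.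
Proof.
case: p => [r| |] //=; first exact: powR_ge0.
have [->|/set0P ne] := eqVneq
  [set e | 0 <= e /\ almost_every (fun x => nrm (f x) <= e)] set0.
  by rewrite inf0.
by apply: lb_le_inf => // e [].
Qed.

Lemma Sp_norm_ae p f g : simple_function f -> simple_function g ->
  almost_every (fun x => f x = g x) -> Sp_norm p f = Sp_norm p g.
Proof.
move=> sf sg fg; case: p => [r| |] //.
  by rewrite !Sp_normE; congr (_ `^ _); exact: simple_integral_ae.
rewrite /Sp_norm; congr (inf _); apply/seteqP; split=> e [e0 ae_e]; split=> //.
  by apply: almost_everyI fg ae_e => x <-.
by apply: almost_everyI fg ae_e => x ->.
Qed.

Let simple_nrm f : simple_function f -> simple_function (fun x => nrm (f x)).
Proof. exact: (@simple_comp _ _ _ _ (@nrm R k V)). Qed.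

Lemma Sp_norm_Lnorm r f : 1 <= r -> simple_function f ->
  Lnorm (@opt_mu R X) r%:E (EFin \o opt_ext (fun x => nrm (f x))) =
  (Sp_norm r%:E f)%:E.
Proof.
move=> r1 sf; rewrite unlock /Lnorm Sp_normE -poweR_EFin -simple_integralE//.
congr (poweR _ _); apply: eq_integral => -[x|] _ /=.
  by rewrite ger0_norm ?nrm_ge0.
by rewrite normr0 powR0// gt_eqF// (lt_le_trans ltr01).
Qed.

Lemma Sp_normD p f g : (1 <= p)%E -> simple_function f -> simple_function g ->
  Sp_norm p (fun x => f x + g x) <= Sp_norm p f + Sp_norm p g.
Proof.
case: p => [r| |] // p1 sf sg; have sfg := simple_comp2 +%R sf sg.
  rewrite -lee_fin EFinD -!Sp_norm_Lnorm//.
  apply: le_trans (minkowski_EFin (@opt_mu R X)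
    (measurable_opt_ext (simple_nrm sf)) (measurable_opt_ext (simple_nrm sg)) p1).
  have mfg := measurable_opt_ext (simple_nrm sfg).
  have mfpg := measurable_funD
    (measurable_opt_ext (simple_nrm sf)) (measurable_opt_ext (simple_nrm sg)).
  rewrite unlock /Lnorm; apply: gt0_ler_poweR.
  - by rewrite invr_ge0 (le_trans ler01).
  - by rewrite in_itv/= leey andbT integral_ge0// => o _; exact: poweR_ge0.
  - by rewrite in_itv/= leey andbT integral_ge0// => o _; exact: poweR_ge0.
  apply: ge0_le_integral => //.
  - by move=> o _; exact: poweR_ge0.
  - apply: (measurableT_comp (measurable_poweR _)).
    by apply: measurableT_comp => //; exact/measurable_EFinP.
  - apply: (measurableT_comp (measurable_poweR _)).
    by apply: measurableT_comp => //; exact/measurable_EFinP.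
  move=> -[x|] _ /=; last by rewrite addr0.
  rewrite lee_fin; apply: ge0_ler_powR; rewrite ?nnegrE//.
    by rewrite (le_trans ler01).
  by rewrite !ger0_norm ?addr_ge0 ?nrm_ge0// nrmD.
apply: Sp_normy_le; first by rewrite addr_ge0// Sp_norm_ge0.
apply: almost_everyI (Sp_normy_ae sf) (Sp_normy_ae sg) => x fx gx.
by apply: le_trans (nrmD _ _) _; exact: lerD.
Qed.

Lemma Sp_normZ p (a : K) f : (1 <= p)%E -> simple_function f ->
  Sp_norm p (fun x => a *: f x) = scalar_Re `|a| * Sp_norm p f.
Proof.
move=> p1.
have le (b : K) (h : X -> V) : simple_function h ->
    Sp_norm p (fun x => b *: h x) <= scalar_Re `|b| * Sp_norm p h.
  move=> sh; have sbh := simple_comp (GRing.scale b) sh.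
  have b0 : 0 <= scalar_Re `|b| by exact: scalar_Re_ge0.
  case: p p1 => [r| |] // p1.
    have r0 : 0 < r by rewrite (lt_le_trans ltr01).
    have bE : scalar_Re `|b| = (scalar_Re `|b| `^ r) `^ r^-1.
      by rewrite -powRrM mulfV ?gt_eqF// powRr1.
    rewrite !Sp_normE {1}bE.
    rewrite -powRM ?powR_ge0 ?simple_integral_ge0//.
    apply: ge0_ler_powR; rewrite ?nnegrE ?invr_ge0 ?(ltW r0)//.
    - by rewrite simple_integral_ge0.
    - by rewrite mulr_ge0 ?powR_ge0 ?simple_integral_ge0.
    rewrite /simple_integral mulr_fsumr.
    under [leRHS]eq_fsbigr do rewrite mulrA.
    apply: (@simple_integral_le _ _ _ _ (powr r)
      (fun v => scalar_Re `|b| `^ r * powr r v)) => //.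
    - by move=> v; rewrite mulr_ge0 ?powR_ge0.
    - by move=> x; rewrite /powr nrmZ powRM ?nrm_ge0.
  apply: Sp_normy_le; first by rewrite mulr_ge0// Sp_norm_ge0.
  apply: almost_everyS (Sp_normy_ae sh) => x hx.
  by rewrite nrmZ ler_wpM2l.
move=> sf; apply/eqP; rewrite eq_le le//=.
have [->|a0] := eqVneq a 0.
  by rewrite normr0 (_ : scalar_Re 0 = 0) ?mul0r ?Sp_norm_ge0//; case: (k).
have sa : 0 < scalar_Re `|a|.
  rewrite lt_neqAle scalar_Re_ge0// andbT eq_sym; apply/eqP => sa.
  by move: (@scalar_ReK R k `|a| (normr_ge0 _)); rewrite sa scalar_of0 => /esym/eqP;
    rewrite normr_eq0 (negbTE a0).
rewrite -ler_pdivlMl//.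
have := le a^-1 _ (simple_comp (GRing.scale a) sf).
rewrite (_ : (fun x => _) = f); last first.
  by apply/funext => x /=; rewrite scalerA mulVf// scale1r.
move/le_trans; apply; rewrite ler_wpM2r ?Sp_norm_ge0//.
rewrite -[leRHS]mul1r ler_pdivlMr// -[leLHS](@scalar_ofK R k) scalar_ofM.
rewrite !scalar_ReK ?normr_ge0// -normrM mulVf// normr1.
by case: (k).
Qed.

Lemma Sp_norm_eq0 p f : (1 <= p)%E -> simple_function f ->
  Sp_norm p f = 0 -> almost_every (fun x => f x = 0).
Proof.
case: p => [r| |] // p1 sf.
  have r0 : r != 0 by rewrite gt_eqF// (lt_le_trans ltr01).
  move=> /eqP; rewrite Sp_normE powR_eq0 invr_eq0 r0 andbT => /eqP.
  move/simple_integral_eq0 => /(_ sf (powr_ge0 r)).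
  apply: almost_everyS => x /eqP; rewrite powR_eq0 => /andP[/eqP fx _].
  exact: nrm0_eq0 fx.
move=> f0; apply: almost_everyS (Sp_normy_ae sf) => x; rewrite f0 => fx.
by apply: (@nrm0_eq0 R k); apply/eqP; rewrite eq_le fx nrm_ge0.
Qed.

Lemma Sp_norm_pair p f g h : (1 <= p)%E -> simple_function f ->
  simple_function g -> simple_function h ->
  (forall x, h x = f x /\ g x = 0 \/ h x = g x /\ f x = 0) ->
  Sp_norm p h <= lp_pair p (Sp_norm p f) (Sp_norm p g).
Proof.
move=> + sf sg sh hfg; case: p => [r| |] // p1.
  rewrite /lp_pair !Sp_normX// Sp_normE.
  rewrite (simple_integralD (phi := powr r) (phi' := powr r) sf sg sh)//.
  have pow0 : nrm (0 : V) `^ r = 0.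
    by rewrite nrm0 powR0// gt_eqF// (lt_le_trans ltr01).
  by move=> x; rewrite /powr; case: (hfg x) => -[-> ->];
    rewrite pow0 ?addr0 ?add0r.
apply: Sp_normy_le; first by rewrite le_max Sp_norm_ge0.
apply: almost_everyI (Sp_normy_ae sf) (Sp_normy_ae sg) => x fx gx.
by case: (hfg x) => -[-> _]; rewrite le_max ?fx ?gx ?orbT.
Qed.

Lemma Sp_norm_cst p (v : V) : (1 <= p)%E ->
  Sp_norm p (fun _ : X => v) <= mass_root p X * nrm v.
Proof.
case: p => [r| |] // p1.
  have r0 : r != 0 by rewrite gt_eqF// (lt_le_trans ltr01).
  have vE : nrm v = (nrm v `^ r) `^ r^-1.
    by rewrite -powRrM mulfV// powRr1// nrm_ge0.
  rewrite Sp_normE [in leRHS]vE /mass_root.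
  rewrite -powRM ?powR_ge0 ?fine_mu_ge0//.
  rewrite (_ : simple_integral _ _ = fine (mu X setT) * powr r v)//.
  rewrite /simple_integral -(@fsbig_widen _ _ _ _ [set v])//.
    rewrite fsbig_set1 mulrC; congr (fine (mu X _) * _).
    exact/seteqP.
  move=> w [_ /= wv]; rewrite (_ : _ @^-1` _ = set0) ?mu_set0 ?mulr0//.
  by apply/seteqP; split=> // x /= /esym.
rewrite /mass_root; case: eqP => [mu0|_].
  rewrite mul0r; apply: Sp_normy_le => //.
  by exists setT; split=> //; exact: msetT.
by rewrite mul1r; apply: Sp_normy_le; [exact: nrm_ge0|exact: almost_everyW].
Qed.

End fixed_space.

Lemma Sp_norm_le (X : measSpace R) (V W : normedModType K) p
    (f : X -> V) (g : X -> W) : (1 <= p)%E ->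
  simple_function f -> simple_function g ->
  (forall x, nrm (f x) <= nrm (g x)) -> Sp_norm p f <= Sp_norm p g.
Proof.
case: p => [r| |] // p1 sf sg fg; last first.
  apply: Sp_normy_le; first exact: Sp_norm_ge0.
  by apply: almost_everyS (Sp_normy_ae sg) => x; exact: le_trans.
have r0 : 0 <= r by rewrite (le_trans ler01).
rewrite !Sp_normE; apply: ge0_ler_powR; rewrite ?invr_ge0 ?nnegrE//.
- by apply: simple_integral_ge0 => v; exact: powR_ge0.
- by apply: simple_integral_ge0 => v; exact: powR_ge0.
apply: simple_integral_le => //.
- by move=> v; exact: powR_ge0.
- by move=> w; exact: powR_ge0.
by move=> x; apply: ge0_ler_powR; rewrite ?nnegrE ?nrm_ge0.
Qed.

Section pullback.
Variables (X Y : measSpace R) (q : pmap Y X) (V : normedModType K).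

Definition extend_zero (f : X -> V) (y : Y) : V :=
  if q y is Some x then f x else 0.

Lemma extend_zero_preimage f v : v != 0 ->
  extend_zero f @^-1` [set v] = q @^-1` (Some @` (f @^-1` [set v])).
Proof.
move=> v0; apply/seteqP; split=> y /=; rewrite /extend_zero.
  case: (q y) => [x fx|/esym/eqP]; first by exists x.
  by rewrite (negbTE v0).
by move=> [x fx <-].
Qed.

Lemma simple_extend_zero f : simple_function f -> simple_function (extend_zero f).
Proof.
move=> [fr mf].
have ext_v v : v != 0 -> mset (extend_zero f @^-1` [set v]).
  by move=> v0; rewrite extend_zero_preimage//; exact: pmap_mset.
have er : finite_set (range (extend_zero f)).
  apply: (@sub_finite_set _ _ (0 |` range f)); last by rewrite finite_setU.
  move=> _ [y _ <-]; rewrite /extend_zero; case: (q y) => [x|]; last by left.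
  by right; exists x.
split=> // v; have [->|v0] := eqVneq v 0; last exact: ext_v.
rewrite -[_ @^-1` _]setCK; apply: msetC.
have -> : ~` (extend_zero f @^-1` [set 0]) =
    \bigcup_(v in range (extend_zero f) `\ 0) (extend_zero f @^-1` [set v]).
  apply/seteqP; split=> [y /= y0|y [w [_ /= w0] /= ->//]].
  by exists (extend_zero f y) => //; split=> //; exists y.
apply: mset_fin_bigcup; first exact: finite_setD.
by move=> w [_ /= /eqP w0]; exact: ext_v.
Qed.

Lemma Sp_norm_extend_zero p f : (1 <= p)%E -> simple_function f ->
  Sp_norm p (extend_zero f) <= Sp_norm p f.
Proof.
case: p => [r| |] // p1 sf.
  rewrite le_eqVlt; apply/orP; left; apply/eqP.
  rewrite /Sp_norm; congr (_ `^ _); apply: eq_fsbigr => v _.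
  have [->|v0] := eqVneq v 0.
    by rewrite nrm0 powR0 ?mul0r// gt_eqF// (lt_le_trans ltr01).
  by rewrite extend_zero_preimage// pmap_mu//; have [] := sf.
apply: Sp_normy_le; first exact: Sp_norm_ge0.
apply: almost_everyS (almost_every_pmap q (Sp_normy_ae sf)) => y.
by rewrite /extend_zero; case: (q y) => // _; rewrite nrm0 Sp_norm_ge0.
Qed.

End pullback.

End Sp_norm_theory.

Section simple_function_space.
Variables (R : realType) (k : ground_field).
Notation K := (scalars R k).
Variables (X : measSpace R) (V : normedModType K).

Definition simple_pred : {pred X -> V} := mem [set f | simple_function f].
Definition simple_pred_key : pred_key simple_pred. Proof. exact. Qed.
Canonical simple_pred_keyed := KeyedPred simple_pred_key.

Lemma simple_submod_closed : submod_closed simple_pred.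
Proof.
split; first by rewrite inE; exact: simple_cst.
move=> a f g; rewrite !inE => sf sg.
by have := simple_comp2 (fun v w => a *: v + w) sf sg.
Qed.

HB.instance Definition _ :=
  GRing.isSubmodClosed.Build K (X -> V) simple_pred simple_submod_closed.

Record simple_fun := SimpleFun {
  simple_val :> X -> V;
  simple_valP : simple_val \in simple_pred }.

HB.instance Definition _ := [isSub for simple_val].
HB.instance Definition _ := [Choice of simple_fun by <:].
HB.instance Definition _ := [SubChoice_isSubLmodule of simple_fun by <:].

Definition to_simple (f : X -> V) (sf : simple_function f) : simple_fun :=
  @SimpleFun f (mem_set sf).

Lemma simple_funP (f : simple_fun) : simple_function f.
Proof. by have := simple_valP f; rewrite inE. Qed.

Definition ae_eq_rel (f g : simple_fun) : bool :=
  `[< almost_every (fun x => f x = g x) >].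

Let ae_refl : reflexive ae_eq_rel.
Proof. by move=> f; apply/asboolP; exact: almost_everyW. Qed.

Let ae_sym : symmetric ae_eq_rel.
Proof.
by move=> f g; apply/asboolP/asboolP; apply: almost_everyS => x ->.
Qed.

Let ae_trans : transitive ae_eq_rel.
Proof.
move=> g f h /asboolP fg /asboolP gh; apply/asboolP.
by apply: almost_everyI fg gh => x ->.
Qed.

Canonical ae_equiv := EquivRel ae_eq_rel ae_refl ae_sym ae_trans.

Definition simple_class : Type := {eq_quot ae_eq_rel}%qT.

HB.instance Definition _ := Choice.on simple_class.
HB.instance Definition _ := EqQuotient.on simple_class.

Definition class_of (f : simple_fun) : simple_class := \pi_simple_class%qT f.

Lemma class_of_eq (f g : simple_fun) :
  class_of f = class_of g <-> almost_every (fun x => f x = g x).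
Proof.
split=> [/eqP|fg]; last by apply/eqP; rewrite eqmodE; apply/asboolP.
by rewrite eqmodE => /asboolP.
Qed.

Lemma class_ofK (u : simple_class) : class_of (repr u) = u.
Proof. exact: reprK. Qed.

Lemma repr_class_of (f : simple_fun) :
  almost_every (fun x => repr (class_of f) x = f x).
Proof. by apply/class_of_eq; rewrite class_ofK. Qed.

Lemma class_ofP (u : simple_class) : exists f, u = class_of f.
Proof. by exists (repr u); rewrite class_ofK. Qed.

Definition class_add (u v : simple_class) := class_of (repr u + repr v).
Definition class_opp (u : simple_class) := class_of (- repr u).
Definition class_scale (a : K) (u : simple_class) := class_of (a *: repr u).

Lemma class_addE f g : class_add (class_of f) (class_of g) = class_of (f + g).
Proof.
apply/class_of_eq; apply: almost_everyI (repr_class_of f) (repr_class_of g).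
move=> x fx gx.
by rewrite -[LHS]/(repr (class_of f) x + repr (class_of g) x) fx gx.
Qed.

Lemma class_oppE f : class_opp (class_of f) = class_of (- f).
Proof.
apply/class_of_eq; apply: almost_everyS (repr_class_of f) => x fx.
by rewrite -[LHS]/(- repr (class_of f) x) fx.
Qed.

Lemma class_scaleE a f : class_scale a (class_of f) = class_of (a *: f).
Proof.
apply/class_of_eq; apply: almost_everyS (repr_class_of f) => x fx.
by rewrite -[LHS]/(a *: repr (class_of f) x) fx.
Qed.

Let class_addA : associative class_add.
Proof.
move=> u v w; have [f ->] := class_ofP u; have [g ->] := class_ofP v.
by have [h ->] := class_ofP w; rewrite !class_addE addrA.
Qed.

Let class_addC : commutative class_add.
Proof.
move=> u v; have [f ->] := class_ofP u; have [g ->] := class_ofP v.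
by rewrite !class_addE addrC.
Qed.

Let class_add0 : left_id (class_of 0) class_add.
Proof. by move=> u; have [f ->] := class_ofP u; rewrite class_addE add0r. Qed.

Let class_addN : left_inverse (class_of 0) class_opp class_add.
Proof.
by move=> u; have [f ->] := class_ofP u; rewrite class_oppE class_addE addNr.
Qed.

HB.instance Definition _ := GRing.isZmodule.Build simple_class
  class_addA class_addC class_add0 class_addN.

Let class_scaleA a b u : class_scale a (class_scale b u) = class_scale (a * b) u.
Proof. by have [f ->] := class_ofP u; rewrite !class_scaleE scalerA. Qed.

Let class_scale1 : left_id 1 class_scale.
Proof. by move=> u; have [f ->] := class_ofP u; rewrite class_scaleE scale1r. Qed.

Let class_scaleDr : right_distributive class_scale +%R.
Proof.
move=> a u v; have [f ->] := class_ofP u; have [g ->] := class_ofP v.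
by rewrite [_ + _ in LHS]class_addE !class_scaleE [RHS]class_addE scalerDr.
Qed.

Let class_scaleDl u : {morph class_scale^~ u : a b / a + b}.
Proof.
move=> a b /=; have [f ->] := class_ofP u.
by rewrite !class_scaleE [RHS]class_addE scalerDl.
Qed.

HB.instance Definition _ := GRing.Zmodule_isLmodule.Build K simple_class
  class_scaleA class_scale1 class_scaleDr class_scaleDl.

Lemma class_ofD f g : class_of (f + g) = class_of f + class_of g.
Proof. by rewrite -class_addE. Qed.

Lemma class_ofZ a f : class_of (a *: f) = a *: class_of f.
Proof. by rewrite -class_scaleE. Qed.

Definition class_norm (p : \bar R) (u : simple_class) : R := Sp_norm p (repr u).

Lemma class_norm_of p f : class_norm p (class_of f) = Sp_norm p f.
Proof.
apply: Sp_norm_ae (repr_class_of f); exact: simple_funP.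
Qed.

(* The norm depends on p, so that S^p(X, V) needs a copy of [simple_class] for
   each p; the proof of [1 <= p] provides the triangle inequality. *)
Definition Sp (p : \bar R) (p1 : (1 <= p)%E) : Type := simple_class.

Section normed_instance.
Variables (p : \bar R) (p1 : (1 <= p)%E).

HB.instance Definition _ := GRing.Lmodule.on (Sp p1).

Let Sp_normK (u : Sp p1) : K := scalar_of k (class_norm p u).

Let Sp_normK_D (u v : Sp p1) : Sp_normK (u + v) <= Sp_normK u + Sp_normK v.
Proof.
rewrite /Sp_normK -scalar_ofD scalar_of_le.
have [f ->] := class_ofP u; have [g ->] := class_ofP v.
rewrite -[class_of f + _]class_ofD !class_norm_of.
by apply: Sp_normD => //; exact: simple_funP.
Qed.

Let Sp_normK_Z (a : K) (u : Sp p1) : Sp_normK (a *: u) = `|a| * Sp_normK u.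
Proof.
rewrite /Sp_normK; have [f ->] := class_ofP u.
rewrite -[a *: _]class_ofZ !class_norm_of.
rewrite (Sp_normZ _ p1 (simple_funP f)) scalar_ofM scalar_ReK//.
Qed.

Let Sp_normK_eq0 (u : Sp p1) : Sp_normK u = 0 -> u = 0.
Proof.
rewrite /Sp_normK; have [f ->] := class_ofP u.
rewrite class_norm_of => /(congr1 (@scalar_Re R k)); rewrite scalar_ofK.
rewrite (_ : scalar_Re 0 = 0); last by case: (k).
by move=> /(Sp_norm_eq0 p1 (simple_funP f)) f0; apply/class_of_eq.
Qed.

HB.instance Definition _ := Lmodule_isNormed.Build K (Sp p1)
  Sp_normK_D Sp_normK_Z Sp_normK_eq0.

Lemma nrm_Sp (f : simple_fun) : nrm (class_of f : Sp p1) = Sp_norm p f.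
Proof. by rewrite /nrm [`|_|]/(Sp_normK _) scalar_ofK class_norm_of. Qed.

End normed_instance.
End simple_function_space.

Section Sp_action.
Variables (R : realType) (k : ground_field).
Notation K := (scalars R k).
Variables (p : \bar R) (p1 : (1 <= p)%E).

Section Sp_map.
Variables (X Y : measSpace R) (q : pmap Y X).
Variables (V W : normedModType K) (T : contraction V W).

(* T o f o q on the domain of q, and 0 elsewhere. *)
Definition pullback_fun (f : X -> V) (y : Y) : W :=
  if q y is Some x then T (f x) else 0.

Lemma pullback_funE f : pullback_fun f = extend_zero q (T \o f).
Proof. by []. Qed.

Lemma simple_pullback (f : X -> V) :
  simple_function f -> simple_function (pullback_fun f).
Proof. by move=> sf; apply: simple_extend_zero; exact: simple_comp. Qed.

Definition simple_map (f : simple_fun X V) : simple_fun Y W :=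
  to_simple (simple_pullback (simple_funP f)).

Definition Sp_map_fun (u : Sp X V p1) : Sp Y W p1 :=
  class_of (simple_map (repr u)).

Lemma Sp_map_fun_class f : Sp_map_fun (class_of f) = class_of (simple_map f).
Proof.
apply/class_of_eq; apply: almost_everyS (almost_every_pmap q (repr_class_of f)).
by move=> y /=; rewrite /pullback_fun; case: (q y) => // x ->.
Qed.

Let Sp_map_fun_linear : linear Sp_map_fun.
Proof.
move=> a u v; have [f ->] := class_ofP u; have [g ->] := class_ofP v.
rewrite -[a *: class_of f]class_ofZ -[class_of _ + _ in LHS]class_ofD.
rewrite !Sp_map_fun_class -[a *: class_of _]class_ofZ -[RHS]class_ofD.
apply/class_of_eq; apply: almost_everyW => y.
rewrite -[RHS]/(a *: pullback_fun f y + pullback_fun g y).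
rewrite [LHS]/(pullback_fun _ y) /pullback_fun; case: (q y) => [x|].
  by rewrite linearP.
by rewrite scaler0 addr0.
Qed.

HB.instance Definition _ :=
  GRing.isLinear.Build K (Sp X V p1) (Sp Y W p1) *:%R Sp_map_fun
    Sp_map_fun_linear.

Let Sp_map_fun_contr (u : Sp X V p1) : `|Sp_map_fun u| <= `|u|.
Proof.
rewrite -2!nrmE scalar_of_le.
have [f ->] := class_ofP u; rewrite Sp_map_fun_class !nrm_Sp.
have sf := simple_funP f; have sTf := simple_comp T sf.
apply: le_trans (Sp_norm_extend_zero q p1 sTf) _.
by apply: Sp_norm_le => // x; apply: scalar_Re_le; exact: contrP.
Qed.

Definition Sp_map : contraction (Sp X V p1) (Sp Y W p1) :=
  @Contraction _ _ (Sp X V p1) (Sp Y W p1) Sp_map_fun Sp_map_fun_contr.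

Lemma Sp_map_class f : Sp_map (class_of f) = class_of (simple_map f).
Proof. exact: Sp_map_fun_class. Qed.

End Sp_map.

Lemma Sp_map_id (X : measSpace R) (V : normedModType K) :
  Sp_map (total_pmap (mp_id X)) (contr_id V) = contr_id (Sp X V p1).
Proof.
apply: contraction_eq => u; have [f ->] := class_ofP u.
by rewrite Sp_map_class; apply/class_of_eq; exact: almost_everyW.
Qed.

Lemma Sp_map_comp (X Y Z : measSpace R) (U V W : normedModType K)
    (q : pmap Y X) (r : pmap Z Y) (T : contraction U V) (S : contraction V W) :
  Sp_map (pmap_comp q r) (contr_comp S T) =
  contr_comp (Sp_map r S) (Sp_map q T).
Proof.
apply: contraction_eq => u; have [f ->] := class_ofP u.
rewrite -[RHS]/(Sp_map r S (Sp_map q T (class_of f))) !Sp_map_class.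
apply/class_of_eq; apply: almost_everyW => z /=.
rewrite /pullback_fun /= /pmap_comp_fun; case: (r z) => //= y.
by rewrite /pullback_fun; case: (q y) => //; rewrite linear0.
Qed.

Definition Sp_functor :
  functor (prod_cat (op_cat (Meas R)) (NVect R k)) (NVect R k).
Proof.
apply: (@Functor (prod_cat (op_cat (Meas R)) (NVect R k)) (NVect R k)
  (fun x => (Sp x.1 x.2 p1 : normedModType K))
  (fun x y f => Sp_map (f.1 : pmap y.1 x.1) (f.2 : contraction x.2 y.2))).
- by move=> x; exact: Sp_map_id.
- by move=> x y z g f; exact: Sp_map_comp.
Defined.

(* [emb_inv i] is the partial map (i(X), i^-1), so that this is the extension by
   zero of T o f o i^-1. *)
Definition Sp_functor_emb :
  functor (prod_cat (Meas_emb R) (NVect R k)) (NVect R k).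
Proof.
apply: (@Functor (prod_cat (Meas_emb R) (NVect R k)) (NVect R k)
  (fun x => (Sp x.1 x.2 p1 : normedModType K))
  (fun x y f => Sp_map (emb_inv (f.1 : embedding x.1 y.1))
                       (f.2 : contraction x.2 y.2))).
- by move=> x; rewrite [emb_inv _]emb_inv_id; exact: Sp_map_id.
- by move=> x y z g f; rewrite [emb_inv _]emb_inv_comp; exact: Sp_map_comp.
Defined.

Section sigma.
Variables (X : measSpace R) (V : normedModType K).

Definition sigma_fun (v : V) : Sp X V p1 :=
  class_of (to_simple (simple_cst X v)).

Let sigma_fun_linear : linear sigma_fun.
Proof.
move=> a u v; rewrite /sigma_fun -[a *: class_of _]class_ofZ -[RHS]class_ofD.
by apply/class_of_eq; exact: almost_everyW.
Qed.

HB.instance Definition _ :=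
  GRing.isLinear.Build K V (Sp X V p1) *:%R sigma_fun sigma_fun_linear.

Lemma sigma_fun_le (v : V) : nrm (sigma_fun v) <= mass_root p X * nrm v.
Proof. by rewrite nrm_Sp; exact: Sp_norm_cst. Qed.

Let sigma_fun_bdd : exists C : R, forall v, nrm (sigma_fun v) <= C * nrm v.
Proof. by exists (mass_root p X) => v; exact: sigma_fun_le. Qed.

Definition sigma : bounded_linear V (Sp X V p1) :=
  @BoundedLinear _ _ V (Sp X V p1) sigma_fun sigma_fun_bdd.

Lemma opnorm_sigma : opnorm sigma <= mass_root p X.
Proof.
apply: ge_inf; first by exists 0 => C [].
split; last exact: sigma_fun_le.
rewrite /mass_root; case: (p) => [r| |] //; first exact: powR_ge0.
by case: ifP.
Qed.

End sigma.

Lemma Sp_map_sigma (X Y : measSpace R) (q : pmap Y X) (V W : normedModType K)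
    (T : contraction V W) : (forall y, q y) -> forall v,
  Sp_map q T (sigma X V v) = sigma Y W (T v).
Proof.
move=> qT v; rewrite Sp_map_class; apply/class_of_eq; apply: almost_everyW => y.
by rewrite /= /pullback_fun; have := qT y; case: (q y).
Qed.

Section complementary.
Variables (X Y Z : measSpace R) (a : embedding Y X) (b : embedding Z X).
Variable V : normedModType K.
Hypothesis ab : complementary a b.

Lemma complementaryP x :
  (exists y, emb_inv a x = Some y /\ emb_inv b x = None) \/
  (exists z, emb_inv a x = None /\ emb_inv b x = Some z).
Proof.
have [ab0 abT] := ab; have : (range a `|` range b) x by rewrite abT.
have abx : ~ (range a x /\ range b x).
  by move=> abx; have : (range a `&` range b) x by []; rewrite ab0.
move=> -[[y _ yx]|[z _ zx]].
- left; exists y; split; first by rewrite -yx; exact: emb_inv_funE.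
  by apply: emb_inv_funN => bx; apply: abx; split=> //; exists y.
- right; exists z; split; last by rewrite -zx; exact: emb_inv_funE.
  by apply: emb_inv_funN => bx; apply: abx; split=> //; exists z.
Qed.

Lemma Sp_map_complementary_sigma v :
  Sp_map (emb_inv a) (contr_id V) (sigma Y V v) +
  Sp_map (emb_inv b) (contr_id V) (sigma Z V v) = sigma X V v.
Proof.
rewrite !Sp_map_class -[LHS]class_ofD; apply/class_of_eq.
apply: almost_everyW => x.
rewrite -[LHS]/(pullback_fun (emb_inv a) (contr_id V) (fun=> v) x +
                pullback_fun (emb_inv b) (contr_id V) (fun=> v) x).
rewrite /pullback_fun.
by case: (complementaryP x) => -[? [-> ->]] /=; rewrite ?addr0 ?add0r.
Qed.

Lemma Sp_map_complementary_norm (u : Sp Y V p1) (w : Sp Z V p1) :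
  nrm (Sp_map (emb_inv a) (contr_id V) u + Sp_map (emb_inv b) (contr_id V) w)
  <= lp_pair p (nrm u) (nrm w).
Proof.
have [f ->] := class_ofP u; have [g ->] := class_ofP w.
rewrite !Sp_map_class -[_ + _]class_ofD !nrm_Sp.
have sf := simple_funP f; have sg := simple_funP g.
pose F := extend_zero (emb_inv a) f; pose G := extend_zero (emb_inv b) g.
have sF : simple_function F by exact: simple_extend_zero.
have sG : simple_function G by exact: simple_extend_zero.
apply: (@le_trans _ _ (lp_pair p (Sp_norm p F) (Sp_norm p G))).
  apply: Sp_norm_pair => //; first exact: simple_funP.
  move=> x.
  have -> : (simple_map (emb_inv a) (contr_id V) f +
             simple_map (emb_inv b) (contr_id V) g) x = F x + G x by [].
  rewrite /F /G /extend_zero.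
  case: (complementaryP x) => -[? [-> ->]]; [left|right].
    by rewrite addr0.
  by rewrite add0r.
by apply: lp_pair_le => //; rewrite ?Sp_norm_ge0// Sp_norm_extend_zero.
Qed.

End complementary.
End Sp_action.

Section bifunctors.
Variables (R : realType) (k : ground_field) (M : category).
Notation K := (scalars R k).
Implicit Types F G : functor (prod_cat M (NVect R k)) (NVect R k).

Definition bif F (X : M) (V : normedModType K) : normedModType K := F (X, V).

Definition bif_map F (X Y : M) (V W : normedModType K) (a : hom X Y)
    (T : contraction V W) : contraction (bif F X V) (bif F Y W) :=
  fhom F ((a, T) : @hom (prod_cat M (NVect R k)) (X, V) (Y, W)).

Definition bif_nat F G (t : nattrans F G) (X : M) (V : normedModType K) :
    contraction (bif F X V) (bif G X V) :=
  t (X, V).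

End bifunctors.

Section NV_categories.
Variables (R : realType) (k : ground_field) (p : \bar R).
Notation K := (scalars R k).
Implicit Types (X Y Z : measSpace R) (V W : normedModType K).

(* The composite equalities of linear maps are stated pointwise. *)
Record NV_emb_ob := NVEmbOb {
  Fe :> functor (prod_cat (Meas_emb R) (NVect R k)) (NVect R k);
  ce : forall X V, bounded_linear V (bif Fe X V);
  NV_emb_O : forall X V W (T : contraction V W) v,
    bif_map Fe (@idm (Meas_emb R) X) T (ce X V v) = ce X W (T v);
  NV_emb_I : forall X Y Z V (a : embedding Y X) (b : embedding Z X),
    complementary a b -> forall v,
    bif_map Fe a (contr_id V) (ce Y V v) +
    bif_map Fe b (contr_id V) (ce Z V v) = ce X V v;
  NV_emb_III : forall X V, opnorm (ce X V) <= mass_root p X;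
  NV_emb_IV : forall X Y Z V (a : embedding Y X) (b : embedding Z X),
    complementary a b -> forall (u : bif Fe Y V) (w : bif Fe Z V),
    nrm (bif_map Fe a (contr_id V) u + bif_map Fe b (contr_id V) w)
    <= lp_pair p (nrm u) (nrm w) }.

Record NV_emb_hom (F G : NV_emb_ob) := NVEmbHom {
  te :> nattrans F G;
  te_c : forall X V v, bif_nat te X V (ce F X V v) = ce G X V v }.

Record NV_ob := NVOb {
  Fm :> functor (prod_cat (op_cat (Meas R)) (NVect R k)) (NVect R k);
  cm : forall X V, bounded_linear V (bif Fm X V);
  NV_O : forall X V W (T : contraction V W) v,
    bif_map Fm (@idm (op_cat (Meas R)) X) T (cm X V v) = cm X W (T v);
  NV_I : forall X Y Z V (a : embedding Y X) (b : embedding Z X),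
    complementary a b -> forall v,
    bif_map Fm (emb_inv a) (contr_id V) (cm Y V v) +
    bif_map Fm (emb_inv b) (contr_id V) (cm Z V v) = cm X V v;
  NV_II : forall X Y V (m : mpmap Y X) v,
    bif_map Fm (total_pmap m) (contr_id V) (cm X V v) = cm Y V v;
  NV_III : forall X V, opnorm (cm X V) <= mass_root p X;
  NV_IV : forall X Y Z V (a : embedding Y X) (b : embedding Z X),
    complementary a b -> forall (u : bif Fm Y V) (w : bif Fm Z V),
    nrm (bif_map Fm (emb_inv a) (contr_id V) u +
         bif_map Fm (emb_inv b) (contr_id V) w)
    <= lp_pair p (nrm u) (nrm w) }.

Record NV_hom (F G : NV_ob) := NVHom {
  tm :> nattrans F G;
  tm_c : forall X V v, bif_nat tm X V (cm F X V v) = cm G X V v }.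

Lemma NV_emb_hom_eq (F G : NV_emb_ob) (s t : NV_emb_hom F G) :
  (forall x, s x = t x) -> s = t.
Proof.
case: s t => [s sc] [t tc] /= e; have st : s = t by exact: nattrans_eq.
by case: t / st tc {e} => tc; congr NVEmbHom; exact: Prop_irrelevance.
Qed.

Lemma NV_hom_eq (F G : NV_ob) (s t : NV_hom F G) :
  (forall x, s x = t x) -> s = t.
Proof.
case: s t => [s sc] [t tc] /= e; have st : s = t by exact: nattrans_eq.
by case: t / st tc {e} => tc; congr NVHom; exact: Prop_irrelevance.
Qed.

Let NV_emb_comp_c (F G H : NV_emb_ob) (t : NV_emb_hom G H)
  (s : NV_emb_hom F G) X V v :
  bif_nat (nat_comp t s) X V (ce F X V v) = ce H X V v.
Proof. by rewrite -(te_c t) -(te_c s). Qed.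

Let NV_comp_c (F G H : NV_ob) (t : NV_hom G H) (s : NV_hom F G) X V v :
  bif_nat (nat_comp t s) X V (cm F X V v) = cm H X V v.
Proof. by rewrite -(tm_c t) -(tm_c s). Qed.

Definition NV_emb : category.
Proof.
apply: (@Category NV_emb_ob NV_emb_hom
  (fun F => @NVEmbHom F F (nat_id F) (fun _ _ _ => erefl))
  (fun F G H t s => @NVEmbHom F H (nat_comp t s) (@NV_emb_comp_c F G H t s))).
- by move=> F G s; apply: NV_emb_hom_eq => x; exact: comp_idl.
- by move=> F G s; apply: NV_emb_hom_eq => x; exact: comp_idr.
- by move=> F G H L r t s; apply: NV_emb_hom_eq => x; exact: comp_assoc.
Defined.

Definition NV : category.
Proof.
apply: (@Category NV_ob NV_hom
  (fun F => @NVHom F F (nat_id F) (fun _ _ _ => erefl))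
  (fun F G H t s => @NVHom F H (nat_comp t s) (@NV_comp_c F G H t s))).
- by move=> F G s; apply: NV_hom_eq => x; exact: comp_idl.
- by move=> F G s; apply: NV_hom_eq => x; exact: comp_idr.
- by move=> F G H L r t s; apply: NV_hom_eq => x; exact: comp_assoc.
Defined.

End NV_categories.

Section Sp_objects.
Variables (R : realType) (k : ground_field) (p : \bar R) (p1 : (1 <= p)%E).
Notation K := (scalars R k).

Definition Sp_sigma_emb : NV_emb k p.
Proof.
apply: (@NVEmbOb R k p (Sp_functor_emb k p1) (sigma p1)).
- move=> X V W T v; apply: Sp_map_sigma => x.
  by rewrite -[x]/(emb_id X x) [emb_inv _ _]emb_inv_funE.
- by move=> X Y Z V a b ab v; exact: Sp_map_complementary_sigma.
- by move=> X V; exact: opnorm_sigma.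
- by move=> X Y Z V a b ab u w; exact: Sp_map_complementary_norm.
Defined.

Definition Sp_sigma : NV k p.
Proof.
apply: (@NVOb R k p (Sp_functor k p1) (sigma p1)).
- by move=> X V W T v; exact: Sp_map_sigma.
- by move=> X Y Z V a b ab v; exact: Sp_map_complementary_sigma.
- by move=> X Y V m v; exact: Sp_map_sigma.
- by move=> X V; exact: opnorm_sigma.
- by move=> X Y Z V a b ab u w; exact: Sp_map_complementary_norm.
Defined.

End Sp_objects.

(* Main.v *)
(* For an object (F, c) and a measurable subset A of X with inclusion i, the map
   v |-> F_(i, id) (c v) is a vector measure in A, additive by (I). The morphism
   S^p -> F is forced to be integration against it:
   f |-> \sum_v F_(i_v, id) (c v), where i_v is the inclusion of f^-1(v).
   Splitting X into complementary parts splits this integral, and every simple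
   function is obtained from constants by finitely many such splittings. Hence
   linearity, naturality, uniqueness and the norm bound (from (III) on constants
   and (IV) on splittings) only have to be checked on constants and preserved by
   splitting. For NV^p one restricts along embeddings; naturality for a partial
   map follows on constants from (II), since a partial map is a total one
   composed with the inverse of the embedding of its domain. *)
From HB Require Import structures.
Require Import Defs.
From mathcomp Require Import all_boot all_order all_algebra.
From mathcomp Require Import all_classical all_reals all_analysis.
(* [mset] is also the name of a library notion. *)
Import Defs.
Set Implicit Arguments.
Unset Strict Implicit.
Unset Printing Implicit Defensive.
Import Order.TTheory GRing.Theory Num.Theory.
Import numFieldNormedType.Exports.
Local Open Scope classical_set_scope.
Local Open Scope ring_scope.

(** * Measurable subsets as measure spaces, and corestriction of embeddings *)

Section subspace.
Variables (R : realType) (X : measSpace R) (A : set X) (mA : mset A).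

Let val : {x | A x} -> X := sval.

Lemma subspace_val_inj : injective val.
Proof.
by move=> [x Ax] [y Ay] /= xy; subst y; congr exist; exact: Prop_irrelevance.
Qed.

Let vmset (B : set {x | A x}) := mset (val @` B).

Lemma subspace_val_setC (B : set {x | A x}) :
  val @` (~` B) = A `&` ~` (val @` B).
Proof.
apply/seteqP; split=> [_ [y nBy <-]|x [Ax nBx]].
  split; first exact: (svalP y).
  by move=> [z Bz /subspace_val_inj zy]; apply: nBy; rewrite -zy.
by exists (exist _ x Ax) => // Bx; apply: nBx; exists (exist _ x Ax).
Qed.

Lemma subspace_val_setT : val @` setT = A.
Proof.
apply/seteqP; split=> [_ [y _ <-]|x Ax]; first exact: (svalP y).
by exists (exist _ x Ax).
Qed.

Let sigma_algebra_vmset : sigma_algebra setT vmset.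
Proof.
split.
- by rewrite /vmset image_set0; exact: mset0.
- move=> B mB; rewrite setTD /vmset subspace_val_setC.
  by apply: msetI => //; exact: msetC.
- move=> B mB; rewrite /vmset image_bigcup.
  by have [_ _] := mset_sigma_algebra X; apply.
Qed.

Let vmu (B : set {x | A x}) : \bar R := mu X (val @` B).

Let vmu0 : vmu set0 = 0%E.
Proof. by rewrite /vmu image_set0 mu_set0. Qed.

Let vmu_ge0 B : (0 <= vmu B)%E.
Proof. exact: mu_ge0. Qed.

Let vmu_sigma_additive (F : (set {x | A x})^nat) : (forall n, vmset (F n)) ->
  trivIset setT F ->
  (fun n => \sum_(0 <= i < n) vmu (F i))%E @ \oo --> vmu (\bigcup_n F n).
Proof.
move=> mF tF; rewrite /vmu image_bigcup; apply: mu_sigma_additive => //.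
move=> i j _ _ [_ [[x Fx <-] [y Fy /subspace_val_inj xy]]].
by apply: (tF i j) => //; exists x; split=> //; rewrite -xy.
Qed.

Let vmu_finite : (vmu setT < +oo)%E.
Proof. by rewrite /vmu subspace_val_setT ltey_eq mu_fin_num. Qed.

Definition subspace : measSpace R :=
  MeasSpace sigma_algebra_vmset vmu0 vmu_ge0 vmu_sigma_additive vmu_finite.

Let val_mset (B : set subspace) : mset B <-> mset (val @` B).
Proof. by []. Qed.

Let val_mu (B : set subspace) : mset B -> mu subspace B = mu X (val @` B).
Proof. by []. Qed.

Definition subspace_emb : embedding subspace X :=
  @Embedding R subspace X val subspace_val_inj val_mset val_mu.

Lemma range_subspace_emb : range subspace_emb = A.
Proof. exact: subspace_val_setT. Qed.

Lemma subspace_embP (y : subspace) : A (subspace_emb y).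
Proof. exact: (svalP y). Qed.

Section corestriction.
Variables (Y : measSpace R) (i : embedding Y X) (iA : forall y, A (i y)).

Let cor (y : Y) : subspace := exist _ (i y) (iA y).

Let cor_inj : injective cor.
Proof. by move=> y z /(congr1 val) /(@emb_inj _ _ _ i). Qed.

Let cor_image (B : set Y) : subspace_emb @` (cor @` B) = i @` B.
Proof. by rewrite image_comp. Qed.

Let cor_mset (B : set Y) : mset B <-> mset (cor @` B).
Proof. by rewrite (emb_mset subspace_emb) cor_image -emb_mset. Qed.

Let cor_mu (B : set Y) : mset B -> mu Y B = mu subspace (cor @` B).
Proof.
move=> mB; rewrite (emb_mu subspace_emb) -?cor_mset// cor_image.
exact: emb_mu.
Qed.

Definition emb_corestr : embedding Y subspace :=
  @Embedding R Y subspace cor cor_inj cor_mset cor_mu.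

Lemma subspace_emb_corestr : emb_comp subspace_emb emb_corestr = i.
Proof. exact: embedding_eq. Qed.

End corestriction.
End subspace.

(** * Preimages under embeddings and complementary pairs *)

Section embedding_theory.
Variable R : realType.
Implicit Types X Y Z : measSpace R.

Lemma mset_range X Y (i : embedding Y X) : mset (range i).
Proof. by rewrite -emb_mset; exact: msetT. Qed.

Lemma emb_image_preimage X Y (i : embedding Y X) (A : set X) :
  i @` (i @^-1` A) = range i `&` A.
Proof.
apply/seteqP; split=> [_ [y Ay <-]|_ [[y _ <-] Ay]]; last by exists y.
by split=> //; exists y.
Qed.

Lemma mset_emb_preimage X Y (i : embedding Y X) (A : set X) :
  mset A -> mset (i @^-1` A).
Proof.
move=> mA; rewrite (emb_mset i) emb_image_preimage.
by apply: msetI => //; exact: mset_range.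
Qed.

Lemma mu_emb_preimage X Y (i : embedding Y X) (A : set X) :
  mset A -> mu Y (i @^-1` A) = mu X (range i `&` A).
Proof.
move=> mA; rewrite (emb_mu i) ?emb_image_preimage//.
exact: mset_emb_preimage.
Qed.

Lemma simple_comp_emb X Y (i : embedding Y X) (V : Type) (f : X -> V) :
  simple_function f -> simple_function (f \o i).
Proof.
move=> [fr mf]; split; last first.
  by move=> v; rewrite comp_preimage; exact: mset_emb_preimage.
by apply: sub_finite_set fr => _ [y _ <-]; exists (i y).
Qed.

Lemma almost_every_emb X Y (i : embedding Y X) (P : X -> Prop) :
  almost_every P -> almost_every (fun y => P (i y)).
Proof.
move=> [N [mN N0 PN]]; exists (i @^-1` N); split.
- exact: mset_emb_preimage.
- rewrite mu_emb_preimage//; apply: negligible_mset.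
    by apply: msetI => //; exact: mset_range.
  by exists N; split=> // x [].
- by move=> y /= nP; exact: (PN (i y)).
Qed.

Lemma muU X (A B : set X) : mset A -> mset B -> A `&` B = set0 ->
  mu X (A `|` B) = (mu X A + mu X B)%E.
Proof.
move=> mA mB AB0; rewrite -3!opt_muE image_setU measureU ?opt_measurable//.
apply/seteqP; split=> // _ [[x Ax <-] [y By [xy]]].
by have : (A `&` B) x; [split=> //; rewrite -xy|rewrite AB0].
Qed.

Lemma complementary_subspace X (A : set X) (mA : mset A) :
  complementary (subspace_emb mA) (subspace_emb (msetC mA)).
Proof.
by rewrite /complementary !range_subspace_emb setICr setUCr.
Qed.

(** This splitting serves to integrate an extension by zero along [i], which vanishes on the second
    piece. *)
Lemma complementary_range X Y (i : embedding Y X) :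
  complementary i (subspace_emb (msetC (mset_range i))).
Proof.
by rewrite /complementary !range_subspace_emb setICr setUCr.
Qed.

Section complementary.
Variables (X Y Z : measSpace R) (a : embedding Y X) (b : embedding Z X).
Hypothesis ab : complementary a b.

Lemma complementary_mu (A : set X) : mset A ->
  mu X A = (mu Y (a @^-1` A) + mu Z (b @^-1` A))%E.
Proof.
move=> mA; have [ab0 abT] := ab; rewrite !mu_emb_preimage// -muU.
- by rewrite -setIUl abT setTI.
- by apply: msetI => //; exact: mset_range.
- by apply: msetI => //; exact: mset_range.
- by rewrite setIACA ab0 set0I.
Qed.

Section restriction.
Variables (A : set X) (mA : mset A).

(** The map that [i] induces from the preimage of [A] to [A], built by corestriction so that the
    square in [restr_embE] commutes. *)
Definition restr_emb (T : measSpace R) (i : embedding T X) :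
    embedding (subspace (mset_emb_preimage i mA)) (subspace mA) :=
  @emb_corestr R X A mA _ (emb_comp i (subspace_emb (mset_emb_preimage i mA)))
    (fun y => @subspace_embP _ _ _ (mset_emb_preimage i mA) y).

Lemma restr_embE (T : measSpace R) (i : embedding T X) :
  emb_comp (subspace_emb mA) (restr_emb i) =
  emb_comp i (subspace_emb (mset_emb_preimage i mA)).
Proof. exact: subspace_emb_corestr. Qed.

(** A point of [A] is hit by exactly one of [a] and [b], and its preimage lies in the preimage of
    [A]. Axiom (I) thus becomes available on [A] itself. *)
Lemma complementary_restr : complementary (restr_emb a) (restr_emb b).
Proof.
have [ab0 abT] := ab; split.
  apply/seteqP; split=> // x [[y _ yx] [z _ zx]].
  have : (range a `&` range b) (sval x); last by rewrite ab0.
  split; first by exists (sval y) => //; rewrite -yx.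
  by exists (sval z) => //; rewrite -zx.
apply/seteqP; split=> // x _.
have : (range a `|` range b) (sval x) by rewrite abT.
case=> -[y _ yx].
  have Ay : A (a y) by rewrite yx; exact: (svalP x).
  by left; exists (exist _ y Ay) => //; apply: subspace_val_inj.
have Ay : A (b y) by rewrite yx; exact: (svalP x).
by right; exists (exist _ y Ay) => //; apply: subspace_val_inj.
Qed.

End restriction.
End complementary.
End embedding_theory.

(** * Induction on simple functions: constants and splittings *)

(* [w0] is the constant value attributed to a function on an empty space. *)
Lemma simple_function_ind (R : realType) (W : choiceType) (w0 : W)
    (P : forall X : measSpace R, (X -> W) -> Prop) :
  (forall (X : measSpace R) (f : X -> W) w, (forall x, f x = w) -> P X f) ->
  (forall (X Y Z : measSpace R) (a : embedding Y X) (b : embedding Z X)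
     (f : X -> W),
    complementary a b -> simple_function f ->
    P Y (f \o a) -> P Z (f \o b) -> P X f) ->
  forall (X : measSpace R) (f : X -> W), simple_function f -> P X f.
Proof.
move=> Pcst Psplit X f sf; have [/finite_seqP[s fs] _] := sf.
have {fs} : range f `<=` [set` s] by rewrite fs.
(* Induction on a list containing the values of [f], over all spaces at once: the level set of the
   head is split off, and on its complement the values lie in the tail. *)
elim: s X f sf => [|w s IH] X f sf fs.
  by apply: (Pcst _ _ w0) => x; have /fs : range f (f x) by exists x.
have mw : mset (f @^-1` [set w]) by have [] := sf.
have cw := complementary_subspace mw.
apply: (Psplit _ _ _ _ _ _ cw sf).
  by apply: (Pcst _ _ w) => y; exact: (subspace_embP y).
apply: IH; first exact: simple_comp_emb.
move=> _ [y _ <-]; have : range f (f (sval y)) by exists (sval y).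
move/fs; rewrite /= inE => /orP[/eqP fy|//].
by have := @subspace_embP _ _ _ (msetC mw) y; case.
Qed.

(** * Operator norm, norms of constants, and norms under splitting *)

Section norm_estimates.
Variables (R : realType) (k : ground_field).
Notation K := (scalars R k).

Lemma nrm_le_opnorm (V W : normedModType K) (f : bounded_linear V W) v :
  nrm (f v) <= opnorm f * nrm v.
Proof.
have [->|v0] := eqVneq v 0; first by rewrite linear0 !nrm0 mulr0.
have v_gt0 : 0 < nrm v.
  rewrite lt_neqAle nrm_ge0 andbT eq_sym.
  by apply: contra_neq v0; exact: nrm0_eq0.
rewrite -ler_pdivrMr//; apply: lb_le_inf.
  (* The constant [C] may be negative, while [opnorm] ranges over nonnegative bounds only. *)
  have [C fC] := bddP f; exists `|C|; split=> // w.
  by apply: le_trans (fC w) _; rewrite ler_wpM2r ?nrm_ge0// ler_norm.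
by move=> C [_ fC]; rewrite ler_pdivrMr.
Qed.

Variables (p : \bar R) (p1 : (1 <= p)%E).

Lemma mass_root_eq0 (X : measSpace R) :
  mu X setT = 0%E -> mass_root p X = 0.
Proof.
case: p p1 => [r| |] //= r1 ->; last by rewrite eqxx.
by rewrite powR0// invr_eq0 gt_eqF// (lt_le_trans ltr01).
Qed.

(** Together with [Sp_norm_cst] this makes the norm of a constant equal to the bound coming from
    (III), so that (III) controls integrals of constants. *)
Lemma mass_root_le_Sp_norm (X : measSpace R) (V : normedModType K)
    (f : X -> V) v :
  (forall x, f x = v) -> mass_root p X * nrm v <= Sp_norm p f.
Proof.
move=> fE; have {f fE} -> : f = fun=> v by exact/funext.
case: p p1 => [r| |] // r1.
  have r0 : r != 0 by rewrite gt_eqF// (lt_le_trans ltr01).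
  have vE : nrm v = (nrm v `^ r) `^ r^-1.
    by rewrite -powRrM mulfV// powRr1// nrm_ge0.
  rewrite /mass_root [in leLHS]vE -powRM ?powR_ge0 ?fine_mu_ge0//.
  rewrite /Sp_norm -(@fsbig_widen _ _ _ _ [set v])//.
    rewrite fsbig_set1 mulrC (_ : _ @^-1` _ = setT)//.
    exact/seteqP.
  move=> w [_ /= wv]; rewrite (_ : _ @^-1` _ = set0) ?mu_set0 ?mulr0//.
  by apply/seteqP; split=> // x /= /esym.
rewrite /mass_root; case: eqP => [_|mu0]; first by rewrite mul0r Sp_norm_ge0.
(* If the essential supremum were below the norm of [v], every point would be exceptional and [X]
   would be null. *)
rewrite mul1r leNgt; apply/negP => ltv; apply: mu0; apply: negligible_mset.
  exact: msetT.
apply: negligible_setS (Sp_normy_ae (simple_cst X v)) => x _ /=.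
by apply/negP; rewrite -ltNge.
Qed.

Lemma simple_integral_complementary (X Y Z : measSpace R) (a : embedding Y X)
    (b : embedding Z X) (V : choiceType) (phi : V -> R) (f : X -> V) :
  complementary a b -> simple_function f ->
  simple_integral phi f =
  simple_integral phi (f \o a) + simple_integral phi (f \o b).
Proof.
move=> ab sf; have [fr mf] := sf.
(* Both restricted integrals are summed over the values of [f]; a value not attained on a piece
   contributes 0. *)
have widen (T : measSpace R) (i : embedding T X) :
    simple_integral phi (f \o i) =
    \sum_(v \in range f) phi v * fine (mu T (i @^-1` (f @^-1` [set v]))).
  apply: esym; apply: fsbig_widen => // v [_ /= fv].
  rewrite (_ : _ @^-1` _ = set0) ?mu_set0 ?mulr0//.
  by apply/seteqP; split=> // y /= iy; apply: fv; exists (i y).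
rewrite simple_integral_range !widen -fsbig_split//; apply: eq_fsbigr => v _ /=.
by rewrite -mulrDr (complementary_mu ab)// fineD// mu_fin_num//;
  exact: mset_emb_preimage.
Qed.

(** For finite exponent the powers of the norms are integrals, which add over the two pieces; for
    infinite exponent an essential bound restricts to each piece. Combined with (IV), this passes a
    norm bound from the pieces to [X]. *)
Lemma lp_pair_Sp_norm (X Y Z : measSpace R) (a : embedding Y X)
    (b : embedding Z X) (V : normedModType K) (f : X -> V) :
  complementary a b -> simple_function f ->
  lp_pair p (Sp_norm p (f \o a)) (Sp_norm p (f \o b)) <= Sp_norm p f.
Proof.
move=> ab sf; case: p p1 => [r| |] // r1.
  rewrite /lp_pair !Sp_normX// Sp_normE.
  by rewrite (simple_integral_complementary _ ab sf).
rewrite /lp_pair ge_max; apply/andP; split;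
  by apply: Sp_normy_le (Sp_norm_ge0 _ _) (almost_every_emb _ (Sp_normy_ae sf)).
Qed.

End norm_estimates.

(** * Inverse embeddings, and functoriality in two variables *)

Lemma emb_inv_Some (R : realType) (X Y : measSpace R) (i : embedding X Y) x y :
  emb_inv i y = Some x -> i x = y.
Proof.
have [[z _ <-]|ny] := pselect (range i y); last first.
  by rewrite [emb_inv i y]emb_inv_funN.
by rewrite [emb_inv i _]emb_inv_funE => -[->].
Qed.

Lemma bif_map_comp (R : realType) (k : ground_field) (M : category)
    (F : functor (prod_cat M (NVect R k)) (NVect R k)) (X Y Z : M)
    (U V W : normedModType (scalars R k)) (b : hom Y Z) (a : hom X Y)
    (T : contraction V W) (S : contraction U V) u :
  bif_map F b T (bif_map F a S u) =
  bif_map F (compose b a) (contr_comp T S) u.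
Proof.
by rewrite /bif_map -[LHS]/(compose (fhom F _) (fhom F _) u) -fhom_comp.
Qed.

Lemma bif_map_comp_id (R : realType) (k : ground_field) (M : category)
    (F : functor (prod_cat M (NVect R k)) (NVect R k)) (X Y Z : M)
    (V : normedModType (scalars R k)) (b : hom Y Z) (a : hom X Y) u :
  bif_map F b (contr_id V) (bif_map F a (contr_id V) u) =
  bif_map F (compose b a) (contr_id V) u.
Proof.
rewrite bif_map_comp; congr (bif_map F _ _ u).
exact: contraction_eq.
Qed.

(** * Integration of simple functions against an object of [NV_emb] *)

Section integral.
Variables (R : realType) (k : ground_field) (p : \bar R) (p1 : (1 <= p)%E).
Notation K := (scalars R k).
Variable F : NV_emb_ob k p.
Implicit Types (X Y Z : measSpace R) (V W : normedModType K).

Definition emb_map X Y V (i : embedding X Y) :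
  contraction (bif F X V) (bif F Y V) := bif_map F i (contr_id V).

Lemma emb_map_comp X Y Z V (j : embedding Y Z) (i : embedding X Y)
    (u : bif F X V) :
  emb_map V j (emb_map V i u) = emb_map V (emb_comp j i) u.
Proof. exact: bif_map_comp_id. Qed.

Lemma nrm_ce X V v : nrm (ce F X V v) <= mass_root p X * nrm v.
Proof.
apply: le_trans (nrm_le_opnorm _ _) _.
by rewrite ler_wpM2r ?nrm_ge0// NV_emb_III.
Qed.

(** (III) bounds the value by a mass root equal to 0. Hence the vector measure vanishes on the empty
    set. *)
Lemma ce_null X V v : mu X setT = 0%E -> ce F X V v = 0.
Proof.
move=> /(mass_root_eq0 p1) X0; apply: (@nrm0_eq0 R k).
apply/eqP; rewrite eq_le nrm_ge0 andbT.
by rewrite (le_trans (nrm_ce _ _))// X0 mul0r.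
Qed.

(* The value on nonmeasurable sets is irrelevant. *)
Definition vmeas X V (A : set X) (v : V) : bif F X V :=
  if pselect (mset A) is left mA then
    emb_map V (subspace_emb mA) (ce F (subspace mA) V v)
  else 0.

Lemma vmeasE X V (A : set X) (mA : mset A) (v : V) :
  vmeas A v = emb_map V (subspace_emb mA) (ce F (subspace mA) V v).
Proof.
by rewrite /vmeas; case: pselect => // mA'; rewrite (Prop_irrelevance mA' mA).
Qed.

Lemma vmeas0 X V (v : V) : vmeas (set0 : set X) v = 0.
Proof.
rewrite (vmeasE (mset0 X)) ce_null ?linear0//.
rewrite (emb_mu (subspace_emb (mset0 X))) ?range_subspace_emb ?mu_set0//.
exact: msetT.
Qed.

(** The full subspace is only a copy of [X], so (I) is applied to it and its empty complement, whose
    contribution is 0. *)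
Lemma vmeasT X V (v : V) : vmeas (setT : set X) v = ce F X V v.
Proof.
rewrite (vmeasE (msetT X)) -(NV_emb_I F (complementary_subspace (msetT X))).
rewrite [ce F (subspace (msetC _)) _ _]ce_null ?linear0 ?addr0//.
rewrite (emb_mu (subspace_emb (msetC (msetT X)))); last exact: msetT.
by rewrite range_subspace_emb setCT mu_set0.
Qed.

(** The preimages of [A] embed as complementary parts of [A]; (I) on [A] is pushed forward to [X]
    through the commuting squares [restr_embE]. *)
Lemma vmeas_complementary X Y Z V (a : embedding Y X) (b : embedding Z X)
    (A : set X) (v : V) : complementary a b -> mset A ->
  vmeas A v =
  emb_map V a (vmeas (a @^-1` A) v) + emb_map V b (vmeas (b @^-1` A) v).
Proof.
move=> ab mA; rewrite (vmeasE mA) -(NV_emb_I F (complementary_restr ab mA)).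
rewrite linearD -![bif_map F (restr_emb _ _) _]/(emb_map V _) !emb_map_comp.
rewrite !restr_embE -!emb_map_comp.
by rewrite -!vmeasE.
Qed.

Definition sint X V (f : X -> V) : bif F X V :=
  \sum_(v \in [set: V]) vmeas (f @^-1` [set v]) v.

Lemma sint_seq X V (f : X -> V) (s : seq V) : uniq s ->
  range f `<=` [set` s] -> sint f = \sum_(v <- s) vmeas (f @^-1` [set v]) v.
Proof.
move=> us fs; rewrite fsbig_seq//; apply/esym/fsbig_widen => // v [_ /= vs].
rewrite (_ : _ @^-1` _ = set0) ?vmeas0//.
by apply/seteqP; split=> // x /= fx; apply: vs; apply: fs; exists x.
Qed.

Lemma sint_cst X V (f : X -> V) v : (forall x, f x = v) -> sint f = ce F X V v.
Proof.
move=> fv; rewrite (@sint_seq _ _ _ [:: v])//; last first.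
  by move=> _ [x _ <-]; rewrite /= inE fv.
rewrite big_seq1 (_ : _ @^-1` _ = setT) ?vmeasT//.
by apply/seteqP; split=> // x _; exact: fv.
Qed.

Lemma sint_complementary X Y Z V (a : embedding Y X) (b : embedding Z X)
    (f : X -> V) : complementary a b -> simple_function f ->
  sint f = emb_map V a (sint (f \o a)) + emb_map V b (sint (f \o b)).
Proof.
move=> ab [/finite_seqP[s fs] mf].
have sub (T : measSpace R) (i : embedding T X) :
    range (f \o i) `<=` [set` undup s].
  move=> _ [y _ <-]; have : range f (f (i y)) by exists (i y).
  by rewrite fs /= mem_undup.
have fu : range f `<=` [set` undup s] by rewrite fs => v; rewrite /= mem_undup.
rewrite (sint_seq (undup_uniq s) fu) !(sint_seq (undup_uniq s) (sub _ _)).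
rewrite !linear_sum -big_split; apply: eq_bigr => v _.
exact: vmeas_complementary.
Qed.

Lemma sint0 X V : sint (fun _ : X => 0 : V) = 0.
Proof. by rewrite (@sint_cst _ _ _ 0)// linear0. Qed.

Lemma sint_linear X V (a : K) (f g : X -> V) :
  simple_function f -> simple_function g ->
  sint (fun x => a *: f x + g x) = a *: sint f + sint g.
Proof.
move=> sf sg.
(* The induction is applied to the pair of [f] and [g], so that both become constant on the same
   pieces. *)
apply: (@simple_function_ind R (V * V)%type (0, 0) (fun X h =>
  sint (fun x => a *: (h x).1 + (h x).2) =
  a *: sint (fun x => (h x).1) + sint (fun x => (h x).2))
  _ _ X (fun x => (f x, g x))); last exact: simple_comp2.
- move=> {X f g sf sg} X h [v w] hE.
  rewrite (@sint_cst _ _ _ (a *: v + w)); last by move=> x; rewrite hE.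
  rewrite (@sint_cst _ _ (fun x => (h x).1) v); last by move=> x; rewrite hE.
  rewrite (@sint_cst _ _ (fun x => (h x).2) w); last by move=> x; rewrite hE.
  by rewrite linearP.
- move=> {X f g sf sg} X Y Z i j h ij sh IHi IHj.
  rewrite (sint_complementary ij (simple_comp (fun w => a *: w.1 + w.2) sh)).
  rewrite (sint_complementary ij (simple_comp fst sh)).
  rewrite (sint_complementary ij (simple_comp snd sh)).
  rewrite [sint (_ \o i)]IHi [sint (_ \o j)]IHj !linearP.
  by rewrite scalerDr addrACA.
Qed.

(** On constants this is (III) with [mass_root_le_Sp_norm]; on a splitting, (IV) with
    [lp_pair_Sp_norm]. *)
Lemma nrm_sint X V (f : X -> V) : simple_function f ->
  nrm (sint f) <= Sp_norm p f.
Proof.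
apply: (@simple_function_ind R V 0 (fun X f => nrm (sint f) <= Sp_norm p f)).
- move=> {X f} X f v fv; rewrite (sint_cst fv).
  exact: le_trans (nrm_ce _ _) (mass_root_le_Sp_norm p1 fv).
- move=> {X f} X Y Z a b f ab sf IHa IHb.
  rewrite (sint_complementary ab sf).
  apply: le_trans (lp_pair_Sp_norm p1 ab sf).
  apply: le_trans (NV_emb_IV ab _ _) _.
  by apply: lp_pair_le => //; exact: nrm_ge0.
Qed.

(** By linearity the difference is the integral of an almost everywhere zero function, and the norm
    bound makes it 0. The integral thus descends to classes. *)
Lemma sint_ae X V (f g : X -> V) : simple_function f -> simple_function g ->
  almost_every (fun x => f x = g x) -> sint f = sint g.
Proof.
move=> sf sg fg; apply/eqP; rewrite -subr_eq0; apply/eqP.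
apply: (@nrm0_eq0 R k); apply/eqP; rewrite eq_le nrm_ge0 andbT.
have -> : sint f - sint g = sint (fun x => -1 *: g x + f x).
  by rewrite sint_linear// scaleN1r addrC.
have sgf := simple_comp2 (fun v w => -1 *: v + w) sg sf.
apply: le_trans (nrm_sint sgf) _.
rewrite (Sp_norm_ae p sgf (simple_cst X 0)).
  apply: le_trans (Sp_norm_cst X 0 p1) _.
  by rewrite nrm0 mulr0.
by apply: almost_everyS fg => x ->; rewrite scaleN1r addNr.
Qed.

(** Split [Y] into the image of [i] and its complement: the extension restricts to [f] on the first
    and to 0 on the second. *)
Lemma sint_emb X Y V (i : embedding X Y) (f : X -> V) : simple_function f ->
  sint (extend_zero (emb_inv i) f) = emb_map V i (sint f).
Proof.
move=> sf.
rewrite (sint_complementary (complementary_range i))//; last first.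
  exact: simple_extend_zero.
rewrite (_ : _ \o i = f); last first.
  by apply/funext => x; rewrite /= /extend_zero [emb_inv i _]emb_inv_funE.
rewrite (_ : _ \o subspace_emb _ = fun=> 0) ?sint0 ?linear0 ?addr0//.
apply/funext => y; rewrite /= /extend_zero [emb_inv i _]emb_inv_funN//.
exact: (@subspace_embP _ _ _ (msetC (mset_range i)) y).
Qed.

(** Constants are handled by (O). Splittings are preserved because the actions of an embedding and
    of [T] commute, both composites being the action of the pair. *)
Lemma sint_contr X V W (T : contraction V W) (f : X -> V) :
  simple_function f ->
  sint (T \o f) = bif_map F (@idm (Meas_emb R) X) T (sint f).
Proof.
apply: (@simple_function_ind R V 0 (fun X f =>
  sint (T \o f) = bif_map F (@idm (Meas_emb R) X) T (sint f))).
- move=> {X f} X f v fv; rewrite (sint_cst fv) NV_emb_O.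
  by apply: sint_cst => x /=; rewrite fv.
- move=> {X f} X Y Z a b f ab sf IHa IHb.
  rewrite (sint_complementary ab (simple_comp T sf)) (sint_complementary ab sf).
  rewrite linearD; congr (_ + _).
    rewrite [sint _]IHa /emb_map !bif_map_comp comp_idl comp_idr.
    by congr (bif_map F _ _ _); exact: contraction_eq.
  rewrite [sint _]IHb /emb_map !bif_map_comp comp_idl comp_idr.
  by congr (bif_map F _ _ _); exact: contraction_eq.
Qed.

Definition sint_class X V (u : Sp X V p1) : bif F X V := sint (repr u : X -> V).

Lemma sint_class_of X V (f : simple_fun X V) :
  sint_class (class_of f : Sp X V p1) = sint f.
Proof. exact: sint_ae (simple_funP _) (simple_funP _) (repr_class_of f). Qed.

Let sint_class_linear X V : linear (@sint_class X V).
Proof.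
move=> a u v; have [f ->] := class_ofP u; have [g ->] := class_ofP v.
rewrite -[a *: class_of f]class_ofZ -[class_of _ + _ in LHS]class_ofD.
rewrite !sint_class_of -sint_linear//; exact: simple_funP.
Qed.

HB.instance Definition _ (X : measSpace R) (V : normedModType K) :=
  GRing.isLinear.Build K (Sp X V p1) (bif F X V) *:%R (@sint_class X V)
    (@sint_class_linear X V).

Let sint_class_contr X V (u : Sp X V p1) : `|sint_class u| <= `|u|.
Proof.
rewrite -2!nrmE scalar_of_le; have [f ->] := class_ofP u.
by rewrite sint_class_of nrm_Sp; apply: nrm_sint; exact: simple_funP.
Qed.

Definition sint_contraction X V : contraction (Sp X V p1) (bif F X V) :=
  @Contraction _ _ (Sp X V p1) (bif F X V) (@sint_class X V)
    (@sint_class_contr X V).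

Lemma sint_contraction_sigma X V v :
  sint_contraction X V (sigma p1 X V v) = ce F X V v.
Proof. by rewrite [LHS]sint_class_of; exact: sint_cst. Qed.

(** The morphism given by [i] and [T] factors as [T] over the identity of [X], followed by [i] over
    the identity of [W]; the factors are [sint_contr] and [sint_emb]. *)
Lemma sint_contraction_natural X Y V W (i : embedding X Y)
    (T : contraction V W) u :
  sint_contraction Y W (Sp_map p1 (emb_inv i) T u) =
  bif_map F i T (sint_contraction X V u).
Proof.
have [f ->] := class_ofP u; have sf := simple_funP f.
rewrite Sp_map_class [LHS]sint_class_of.
rewrite -[_ (class_of f)]/(sint_class (class_of f)) sint_class_of.
rewrite -[LHS]/(sint (extend_zero (emb_inv i) (T \o f))).
rewrite sint_emb ?sint_contr//; last exact: simple_comp.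
rewrite /emb_map bif_map_comp comp_idr; congr (bif_map F _ _ _).
exact: contraction_eq.
Qed.

(** A simple function is the sum of the extensions by zero of its two restrictions, so [t] is
    determined by its values on constants. Stated for a bare family of contractions, this serves
    both categories. *)
Lemma sint_unique (t : forall X V, contraction (Sp X V p1) (bif F X V)) :
  (forall X V v, t X V (sigma p1 X V v) = ce F X V v) ->
  (forall X Y V (i : embedding X Y) u,
    t Y V (Sp_map p1 (emb_inv i) (contr_id V) u) = emb_map V i (t X V u)) ->
  forall X V u, t X V u = sint_contraction X V u.
Proof.
move=> tc tn X V u; have [f ->] := class_ofP u.
rewrite [RHS]sint_class_of.
(* The induction runs over bare functions, hence the quantification over the proof [sf], on which
   the class does not depend. *)
suff /(_ X f (simple_funP f)) : forall X (f : X -> V), simple_function f ->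
    forall sf : simple_function f, t X V (class_of (to_simple sf)) = sint f.
  move=> /(_ (simple_funP f)) <-; congr (t X V _).
  by apply/class_of_eq; exact: almost_everyW.
apply: (@simple_function_ind R V 0 (fun X f => forall sf : simple_function f,
  t X V (class_of (to_simple sf)) = sint f)).
- move=> {X u f} X f v fv sf; rewrite (sint_cst fv) -tc; congr (t X V _).
  by apply/class_of_eq; exact: almost_everyW.
- move=> {X u f} X Y Z a b f ab sf IHa IHb sf'.
  have sfa := simple_comp_emb a sf; have sfb := simple_comp_emb b sf.
  rewrite (sint_complementary ab sf) -(IHa sfa) -(IHb sfb) -!tn -linearD.
  congr (t X V _); rewrite !Sp_map_class -[RHS]class_ofD.
  apply/class_of_eq; apply: almost_everyW => x.
  rewrite -[RHS]/(pullback_fun (emb_inv a) (contr_id V) (f \o a) x +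
                  pullback_fun (emb_inv b) (contr_id V) (f \o b) x).
  rewrite /pullback_fun.
  (* Each point lies in exactly one of the two images, where the matching extension recovers [f] and
     the other one is 0. *)
  by case: (complementaryP ab x) => -[y [xa xb]];
    rewrite xa xb ?addr0 ?add0r /=; congr f; apply/esym;
    exact: emb_inv_Some.
Qed.

End integral.

(** * Restricting an object of [NV] to embeddings *)

Section restriction_to_embeddings.
Variables (R : realType) (k : ground_field).
Notation K := (scalars R k).

Section functor.
Variable F : functor (prod_cat (op_cat (Meas R)) (NVect R k)) (NVect R k).

Definition emb_functor :
  functor (prod_cat (Meas_emb R) (NVect R k)) (NVect R k).
Proof.
apply: (@Functor (prod_cat (Meas_emb R) (NVect R k)) (NVect R k)
  (fun x => F x)
  (fun x y f => @fhom _ _ F x y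
    (emb_inv (f.1 : embedding x.1 y.1), f.2 : contraction x.2 y.2))).
- by move=> x; rewrite [emb_inv _]emb_inv_id -fhom_id.
- by move=> x y z g f; rewrite [emb_inv _]emb_inv_comp -fhom_comp.
Defined.

End functor.

(** Forgets (II). The integral built for [NV_emb] then applies to objects of [NV], and naturality
    along partial maps remains to be shown. *)
Definition emb_object (p : \bar R) (F : NV_ob k p) : NV_emb_ob k p.
Proof.
apply: (@NVEmbOb R k p (emb_functor F) (cm F)).
- move=> X V W T v; rewrite -(NV_O F).
  by congr (bif_map F _ T _); exact: emb_inv_id.
- by move=> X Y Z V a b ab v; exact: (NV_I F).
- exact: (NV_III F).
- by move=> X Y Z V a b ab u w; exact: NV_IV.
Defined.

End restriction_to_embeddings.

(** * Factoring a partial map through its domain *)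

Section partial_maps.
Variable R : realType.
Variables (X Y : measSpace R) (q : pmap Y X).

Let D : set Y := q @^-1` (Some @` setT).

Lemma mset_pmap_domain : mset D.
Proof. by apply: pmap_mset; exact: msetT. Qed.

Let S := subspace mset_pmap_domain.

Let defined (y : S) : exists x, q (sval y) = Some x.
Proof. by have [x _ qx] := svalP y; exists x. Qed.

Let value (y : S) : X := projT1 (cid (defined y)).

Let valueE (y : S) : q (sval y) = Some (value y).
Proof. by rewrite /value; case: cid. Qed.

Let value_preimage (B : set X) :
  subspace_emb mset_pmap_domain @` (value @^-1` B) = q @^-1` (Some @` B).
Proof.
apply/seteqP; split=> [_ [y By <-]|y [x Bx qx]].
  by exists (value y) => //; rewrite -valueE.
have Dy : D y by exists x.
exists (exist _ y Dy) => //=; have := valueE (exist _ y Dy).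
by rewrite /= -qx => -[<-].
Qed.

Let value_mset (B : set X) : mset B -> mset (value @^-1` B).
Proof.
move=> mB; rewrite (emb_mset (subspace_emb mset_pmap_domain)) value_preimage.
exact: pmap_mset.
Qed.

Let value_mu (B : set X) : mset B -> mu S (value @^-1` B) = mu X B.
Proof.
move=> mB.
rewrite (emb_mu (subspace_emb mset_pmap_domain)); last exact: value_mset.
by rewrite value_preimage pmap_mu.
Qed.

Definition pmap_total : mpmap S X := MPMap value_mset value_mu.

(** Separates the total part of [q], to which (II) applies, from the inclusion of its domain, which
    is an embedding. *)
Lemma pmap_factor :
  pmap_comp (total_pmap pmap_total)
    (emb_inv (subspace_emb mset_pmap_domain)) = q.
Proof.
apply: pmap_eq => y; rewrite /= /pmap_comp_fun.
have [Dy|nDy] := pselect (D y).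
  have := emb_inv_funE (subspace_emb mset_pmap_domain) (exist _ y Dy).
  by rewrite /emb_inv /= => -> /=; rewrite -valueE.
rewrite [emb_inv _ _]emb_inv_funN ?range_subspace_emb//=.
by case qy : (q y) => [x|//]; case: nDy; exists x.
Qed.

End partial_maps.

(** * Naturality of the integral along partial maps *)

Section partial_maps_integral.
Variables (R : realType) (k : ground_field) (p : \bar R) (p1 : (1 <= p)%E).
Notation K := (scalars R k).
Variable F : NV_ob k p.
Let E : NV_emb_ob k p := emb_object F.

Lemma sint_pmap (X Y : measSpace R) (V : normedModType K) (q : pmap Y X)
    (f : X -> V) : simple_function f ->
  sint E (extend_zero q f) =
  bif_map F (q : @hom (op_cat (Meas R)) X Y) (contr_id V) (sint E f).
Proof.
(* [Y] and [q] stay general, because the splitting step uses the induction hypotheses for [q]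
   followed by [emb_inv a] or [emb_inv b]. *)
move=> sf; move: sf Y q; apply: (@simple_function_ind R V 0 (fun X f =>
  forall (Y : measSpace R) (q : pmap Y X), sint E (extend_zero q f) =
  bif_map F (q : @hom (op_cat (Meas R)) X Y) (contr_id V) (sint E f))).
- move=> {X f} X f v fv Y q.
  rewrite (sint_cst p1 _ fv).
  (* For constant [f] the extension depends on the domain of [q] only, so [q] is replaced by the
     inverse of the inclusion of that domain; (II) for [pmap_total] then brings [q] back. *)
  rewrite (_ : extend_zero q f =
    extend_zero (emb_inv (subspace_emb (mset_pmap_domain q))) (fun=> v)).
    rewrite (sint_emb p1); last exact: simple_cst.
    rewrite (@sint_cst _ _ _ p1 _ _ _ _ v)//.
    rewrite -[ce E _ _ _](NV_II F (pmap_total q)).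
    rewrite -[in RHS](pmap_factor q).
    exact: (@bif_map_comp_id R k (op_cat (Meas R)) F _ _ _ V
      (emb_inv (subspace_emb (mset_pmap_domain q)))
      (total_pmap (pmap_total q))).
  apply/funext => y; rewrite /extend_zero.
  rewrite -{1}(pmap_factor q).
  rewrite -[pmap_fun (pmap_comp _ _) y]/(obind (total_pmap (pmap_total q))
    (emb_inv (subspace_emb (mset_pmap_domain q)) y)).
  by case: (emb_inv _ y) => [z|//]; exact: fv.
- move=> {X f} X Y Z a b f ab sf IHa IHb T q.
  have sfa := simple_comp_emb a sf; have sfb := simple_comp_emb b sf.
  rewrite (sint_complementary p1 E ab sf) linearD.
  rewrite /emb_map.
  have step (U : measSpace R) (i : embedding U X) (u : bif F U V) :
      bif_map F (q : @hom (op_cat (Meas R)) X T) (contr_id V)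
        (bif_map E i (contr_id V) u) =
      bif_map F (pmap_comp (emb_inv i) q : @hom (op_cat (Meas R)) U T)
        (contr_id V) u.
    exact: bif_map_comp_id.
  rewrite !step -IHa -IHb.
  (* The extension of [f] along [q] is the sum of the extensions of its restrictions along the two
     composites; linearity with scalar 1 gives additivity. *)
  have := sint_linear p1 E 1 (simple_extend_zero (pmap_comp (emb_inv a) q) sfa)
    (simple_extend_zero (pmap_comp (emb_inv b) q) sfb).
  rewrite scale1r => <-; congr (sint E _).
  apply/funext => t; rewrite scale1r /extend_zero /= /pmap_comp_fun.
  case: (q t) => [x|] /=; last by rewrite addr0.
  by case: (complementaryP ab x) => -[y [xa xb]];
    rewrite [emb_inv_fun a x]xa [emb_inv_fun b x]xb ?addr0 ?add0r /=; congr f;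
    apply/esym; exact: emb_inv_Some.
Qed.

Lemma sint_contraction_pmap (X Y : measSpace R) (V W : normedModType K)
    (q : pmap Y X) (T : contraction V W) u :
  sint_contraction p1 E Y W (Sp_map p1 q T u) =
  bif_map F (q : @hom (op_cat (Meas R)) X Y) T (sint_contraction p1 E X V u).
Proof.
have [f ->] := class_ofP u; have sf := simple_funP f.
rewrite Sp_map_class [LHS]sint_class_of.
rewrite -[sint_contraction _ _ _ _ _]/(sint_class E (class_of f : Sp X V p1)).
rewrite sint_class_of.
rewrite -[LHS]/(sint E (extend_zero q (T \o f))).
rewrite sint_pmap; last exact: simple_comp.
rewrite (sint_contr p1)//.
(* In [E] the identity acts through [emb_inv] of the identity embedding, which [emb_inv_id]
   identifies with the identity partial map. *)
rewrite (_ : bif_map E _ T _ =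
  bif_map F (@idm (op_cat (Meas R)) X) T (sint E f)); last first.
  by congr (bif_map F _ T _); exact: emb_inv_id.
rewrite bif_map_comp comp_idr; congr (bif_map F _ _ _).
exact: contraction_eq.
Qed.

End partial_maps_integral.

(** * Initiality in both categories *)

Lemma Sp_sigma_emb_initial (R : realType) (k : ground_field) (p : \bar R)
    (p1 : (1 <= p)%E) : initial_object (Sp_sigma_emb k p1).
Proof.
move=> F; pose t (x : prod_cat (Meas_emb R) (NVect R k)) :
    @hom (NVect R k) (Sp_functor_emb k p1 x) (Fe F x) :=
  let: (X, V) := x in sint_contraction p1 F X V.
have tn x y (f : hom x y) : compose (t y) (fhom (Sp_functor_emb k p1) f) =
    compose (fhom F f) (t x).
  case: x y f => [X V] [Y W] [i T]; apply: contraction_eq => u.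
  exact: (@sint_contraction_natural R k p p1 F X Y V W i T u).
exists (@NVEmbHom _ _ _ (Sp_sigma_emb k p1) F (NatTrans tn)
  (fun X V v => sint_contraction_sigma p1 F X v)).
move=> g; apply: NV_emb_hom_eq => -[X V]; apply: contraction_eq => u.
apply: (@sint_unique R k p p1 F (fun X V => g (X, V))).
- exact: (te_c g).
- move=> {X V u} X Y V i u.
  have := nat_natural (te g) ((i, contr_id V) :
    @hom (prod_cat (Meas_emb R) (NVect R k)) (X, V) (Y, V)).
  by move=> /(congr1 (fun h : contraction _ _ => h u)).
Qed.

Lemma Sp_sigma_initial (R : realType) (k : ground_field) (p : \bar R)
    (p1 : (1 <= p)%E) : initial_object (Sp_sigma k p1).
Proof.
move=> F; pose t (x : prod_cat (op_cat (Meas R)) (NVect R k)) :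
    @hom (NVect R k) (Sp_functor k p1 x) (Fm F x) :=
  let: (X, V) := x in sint_contraction p1 (emb_object F) X V.
have tn x y (f : hom x y) : compose (t y) (fhom (Sp_functor k p1) f) =
    compose (fhom F f) (t x).
  case: x y f => [X V] [Y W] [q T]; apply: contraction_eq => u.
  exact: (@sint_contraction_pmap R k p p1 F X Y V W q T u).
exists (@NVHom _ _ _ (Sp_sigma k p1) F (NatTrans tn)
  (fun X V v => sint_contraction_sigma p1 (emb_object F) X v)).
move=> g; apply: NV_hom_eq => -[X V]; apply: contraction_eq => u.
apply: (@sint_unique R k p p1 (emb_object F) (fun X V => g (X, V))).
- exact: (tm_c g).
(* Uniqueness follows from the embedding case: a morphism of [NV] is natural in particular along the
   inverses of embeddings. *)
- move=> {X V u} X Y V i u.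
  have := nat_natural (tm g) ((emb_inv i, contr_id V) :
    @hom (prod_cat (op_cat (Meas R)) (NVect R k)) (X, V) (Y, V)).
  by move=> /(congr1 (fun h : contraction _ _ => h u)).
Qed.

Theorem theorem2p19 (R : realType) (k : ground_field) (p : \bar R)
    (p1 : (1 <= p)%E) :
  initial_object (Sp_sigma_emb k p1) /\ initial_object (Sp_sigma k p1).
Proof. by split; [exact: Sp_sigma_emb_initial|exact: Sp_sigma_initial]. Qed.
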